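(* Let $1<\alpha<2$. Let $\{G(n)\}$ be a sequence of random intersection graphs $G(n)=G(n,m,P)$, $m=m(n)\to\infty$, $P=P(n)$, satisfying condition (A) and condition (PL) with this $\alpha$, some slowly varying function $L$ and some $\varepsilon_0\in(0,1/2)$. Suppose that for some $\beta>\max\{2-\alpha,\alpha-1\}$ we have $m(n)=\Omega(n^\beta)$. Then $$\omega(G(n))=(1+o_P(1))\,(1-\alpha/2)^{-\alpha/2}K(n),\qquad K(n)=L\big((n\ln n)^{1/2}\big)\,n^{1-\alpha/2}(\ln n)^{-\alpha/2}.$$
   Context: Random intersection graph: given positive integers $n,m$ and a probability measure $P$ on $\{0,1,\dots,m\}$, $G(n,m,P)$ has vertex set $V=[n]=\{1,\dots,n\}$ and attribute set $W=\{w_1,\dots,w_m\}$; independent random subsets $S_1,\dots,S_n\subseteq W$ are drawn with $\mathbb P(S_v=S)=P(|S|)/\binom{m}{|S|}$ for every $S\subseteq W$, and distinct $u,v$ are adjacent iff $S_u\cap S_v\neq\emptyset$. Write $X_v=|S_v|$. For a sequence $G(n)=G(n,m(n),P(n))$, $X(n)$ denotes a random variable with law $P(n)$ and $Y(n)=(n/m)^{1/2}X(n)$. All limits are as $n\to\infty$; $o_P,O_P$ are the usual stochastic order symbols; $\omega(G)$ is the clique number. Condition (A): $\mathbb E\,Y(n)=O(1)$. Condition (PL): for the given $\alpha>0$, slowly varying $L:\mathbb R_+\to\mathbb R_+$ (i.e. $L(tx)/L(x)\to1$ as $x\to\infty$ for each $t>0$) and $\varepsilon_0\in(0,1/2)$,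 for every sequence $x_n$ with $n^{1/2-\varepsilon_0}\le x_n\le n^{1/2+\varepsilon_0}$ one has $\mathbb P(Y(n)\ge x_n)\sim L(x_n)x_n^{-\alpha}$. *)

(* Defs.v *)
From Stdlib Require Import Reals.
From mathcomp Require Import all_boot.
Set Implicit Arguments. Unset Strict Implicit. Unset Printing Implicit Defensive.
Local Open Scope R_scope.

Definition Rleb (x y : R) : bool := if Rle_dec x y then true else false.
Definition Rltb (x y : R) : bool := if Rlt_dec x y then true else false.

(* An outcome of G(n,m,P): the attribute sets S_1..S_n, vertices are 'I_n,
   attributes w_1..w_m are 'I_m. *)
Definition config (n m : nat) := {ffun 'I_n -> {set 'I_m}}.

Definition is_prob_law (m : nat) (P : nat -> R) : Prop :=
  (forall k, (k <= m)%N -> (0 <= P k)) /\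
  (\big[Rplus/0]_(0 <= k < m.+1) P k) = 1.

(* P(S_v = S) = P(|S|)/binom(m,|S|), independently over v. *)
Definition config_prob (n m : nat) (P : nat -> R) (f : config n m) : R :=
  \big[Rmult/1]_(v : 'I_n) (P #|f v| / INR 'C(m, #|f v|)).

Definition rig_prob (n m : nat) (P : nat -> R) (E : pred (config n m)) : R :=
  \big[Rplus/0]_(f : config n m | E f) config_prob P f.

Definition adjacent (n m : nat) (f : config n m) (u v : 'I_n) : bool :=
  (u != v) && (f u :&: f v != set0).

Definition is_clique (n m : nat) (f : config n m) (A : {set 'I_n}) : bool :=
  [forall u in A, forall v in A, (u != v) ==> adjacent f u v].

Definition clique_number (n m : nat) (f : config n m) : nat :=
  \max_(A : {set 'I_n} | is_clique f A) #|A|.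

(* Y(n) = (n/m)^{1/2} X(n), X(n) ~ P. *)
Definition scaleY (n m : nat) : R := sqrt (INR n / INR m).

Definition EY (n m : nat) (P : nat -> R) : R :=
  (scaleY n m * \big[Rplus/0]_(0 <= k < m.+1) (INR k * P k)).

Definition tailY (n m : nat) (P : nat -> R) (x : R) : R :=
  \big[Rplus/0]_(0 <= k < m.+1 | Rleb x (scaleY n m * INR k)) P k.

Definition slowly_varying (L : R -> R) : Prop :=
  (forall x, (0 < x) -> (0 < L x)) /\
  forall t, (0 < t) -> forall eps, (0 < eps) ->
    exists M, forall x, (M < x) -> (Rabs (L (t * x) / L x - 1) < eps).

Definition condA (m : nat -> nat) (P : nat -> nat -> R) : Prop :=
  exists C N, forall n, (N <= n)%N -> (EY n (m n) (P n) <= C).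

Definition condPL (m : nat -> nat) (P : nat -> nat -> R)
    (alpha : R) (L : R -> R) (eps0 : R) : Prop :=
  forall x : nat -> R,
    (forall n, Rpower (INR n) (/2 - eps0) <= x n <= Rpower (INR n) (/2 + eps0)) ->
    Un_cv (fun n => tailY n (m n) (P n) (x n) / (L (x n) * Rpower (x n) (- alpha))) 1.

Definition Kn (L : R -> R) (alpha : R) (n : nat) : R :=
  (L (sqrt (INR n * ln (INR n))) * Rpower (INR n) (1 - alpha / 2)
     * Rpower (ln (INR n)) (- (alpha / 2))).

(* Main.v *)
(** Put a = 1 - alpha/2, and let tau be close to a.  Call a vertex large if
    Y >= (tau n ln n)^(1/2).  By (PL) and Chernoff's inequality the number of
    large vertices is about tau^(-alpha/2) K(n), where K(n) = n^(a + o(1)).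

    Two large vertices are nonadjacent with probability at most n^(-tau).  If
    tau > a, then K(n)^2 n^(-tau) = o(K(n)), so that deleting one vertex from each
    nonadjacent pair of large vertices leaves a clique of almost all of them.

    If tau < a, then for some g > 0, with high probability no 2 n^(a-g) of the
    other vertices form a clique.  Otherwise let B and C be halves of it.  With
    high probability the attribute sets of B have pairwise intersections of size
    at most n^g (their mean size is O(ln n)) and each attribute lies in at most
    n^(a-2g) of them (the mean is O((n/m)^(1/2)), which is where beta > alpha - 1
    enters).  Since beta > 2 - alpha, a random set rarely meets the attributes
    common to several sets of B, so a vertex of C must meet at least half of the
    sets of B in disjoint private parts, each being missed with probability about
    n^(-tau); this has probability O(exp(-n^g/32)).  The events for the vertices
    of C are independent given B, which beats the union bound over B and C. *)

From Stdlib Require Import Reals Lra Lia ClassicalEpsilon.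
From mathcomp Require Import all_boot all_order all_algebra.
From mathcomp Require Import zify.
From mathcomp Require ring lra.
From mathcomp Require Import Rstruct.
Require Import Defs.
Set Implicit Arguments. Unset Strict Implicit. Unset Printing Implicit Defensive.

(** * Finite product measures *)

(** The value tau = a is critical because sets of s = (tau m ln n)^(1/2) attributes miss each other
    with probability about exp(-s^2/m) = n^(-tau), while there are about n^a large vertices. As
    tau^(-alpha/2) is continuous in tau, letting tau tend to a from both sides gives the constant
    a^(-alpha/2).

    The obstacle in the upper bound is dependence: adjacencies inside a clique are not independent,
    and neither are the attributes of a random set of prescribed size. The first is dealt with by
    exposing only one half of the clique. For the second, increasing events of a uniform set of at
    most s attributes are compared with a Bernoulli set that reaches size s with probability at
    least 1/2, at the cost of a factor 2. The choice of B and C costs at most n^(2i); independence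
    over C puts the power i on the hitting probability too, so that this only has to beat n^(-2). *)

Section ProductMeasure.
Import ring lra Order.TTheory GRing.Theory Num.Theory.
Local Open Scope ring_scope.
Variables (R : realFieldType) (I T : finType) (mu : T -> R).
Hypothesis mu_ge0 : forall t, 0 <= mu t.
Hypothesis mu_sum1 : \sum_t mu t = 1.

Definition weight (f : {ffun I -> T}) : R := \prod_i mu (f i).
Definition expect (g : {ffun I -> T} -> R) : R := \sum_f weight f * g f.
Definition prob (E : pred {ffun I -> T}) : R := expect (fun f => (E f)%:R).
Definition splice (A : {set I}) (f f' : {ffun I -> T}) : {ffun I -> T} :=
  [ffun i => if i \in A then f' i else f i].

Lemma weight_ge0 f : 0 <= weight f.
Proof. by apply: prodr_ge0 => i _; apply: mu_ge0. Qed.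

Lemma eq_expect g h : g =1 h -> expect g = expect h.
Proof. by move=> e; apply: eq_bigr => f _; rewrite e. Qed.

Lemma expect_prod (phi : I -> T -> R) :
  expect (fun f => \prod_i phi i (f i)) = \prod_i \sum_t mu t * phi i t.
Proof.
rewrite bigA_distr_bigA /=; apply: eq_bigr => f _.
by rewrite /weight -big_split.
Qed.

Lemma sum_weight : \sum_f weight f = 1.
Proof.
by rewrite -(bigA_distr_bigA (fun _ t => mu t)) /= big1.
Qed.

Lemma expect_cst (c : R) : expect (fun=> c) = c.
Proof. by rewrite /expect -mulr_suml sum_weight mul1r. Qed.

Lemma le_expect g h : (forall f, g f <= h f) -> expect g <= expect h.
Proof. by move=> le_gh; apply: ler_sum => f _; rewrite ler_wpM2l ?weight_ge0. Qed.

Lemma expectZ c g : expect (fun f => c * g f) = c * expect g.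
Proof. by rewrite mulr_sumr; apply: eq_bigr => f _; rewrite mulrCA. Qed.

Lemma expect_sum (J : Type) (r : seq J) (Q : pred J) (g : J -> {ffun I -> T} -> R) :
  expect (fun f => \sum_(j <- r | Q j) g j f) = \sum_(j <- r | Q j) expect (g j).
Proof.
rewrite exchange_big; apply: eq_bigr => f _.
by rewrite mulr_sumr.
Qed.

(** Exchanging the coordinates in [A] between two independent copies preserves the product weight.
    This is how independence enters: [A] may be resampled while the other coordinates stay
    frozen. *)
Lemma expect_splice A g :
  expect g = expect (fun f => expect (fun f' => g (splice A f f'))).
Proof.
pose sw (p : {ffun I -> T} * {ffun I -> T}) := (splice A p.1 p.2, splice A p.2 p.1).
have swK : involutive sw.
  move=> [f f']; congr (_, _); apply/ffunP => i; rewrite !ffunE /=;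
  by case: (i \in A).
have wsw p : weight (sw p).1 * weight (sw p).2 = weight p.1 * weight p.2.
  rewrite /weight -!big_split; apply: eq_bigr => i _ /=.
  by rewrite !ffunE; case: ifP => // _; rewrite mulrC.
transitivity (\sum_(p : {ffun I -> T} * {ffun I -> T})
    weight p.1 * weight p.2 * g p.1).
  rewrite -(pair_bigA _ (fun f f' => weight f * weight f' * g f)) /=.
  apply: eq_bigr => f _; under eq_bigr do rewrite mulrAC.
  by rewrite -mulr_sumr sum_weight mulr1.
rewrite (reindex_inj (inv_inj swK)) /=.
under eq_bigr do rewrite wsw.
rewrite -(pair_bigA _ (fun f f' => weight f * weight f' * g (splice A f f'))) /=.
by apply: eq_bigr => f _; rewrite mulr_sumr; apply: eq_bigr => f' _; rewrite mulrA.
Qed.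

Lemma expect_marginal i (h : T -> R) : expect (fun f => h (f i)) = \sum_t mu t * h t.
Proof.
pose phi k t := if k == i then h t else 1.
rewrite (eq_expect (h := fun f => \prod_k phi k (f k))); last first.
  by move=> f; rewrite (bigD1 i) //= big1 ?mulr1 /phi ?eqxx // => k /negPf ->.
rewrite expect_prod (bigD1 i) //= [X in _ * X]big1 ?mulr1 /phi ?eqxx //.
by move=> k /negPf ->; under eq_bigr do rewrite mulr1.
Qed.

Lemma expect_marginal2 i j (h : T -> T -> R) : i != j ->
  expect (fun f => h (f i) (f j)) = \sum_t mu t * \sum_t' mu t' * h t t'.
Proof.
move=> ij; rewrite (expect_splice [set j]).
rewrite -(expect_marginal i (fun t => \sum_t' mu t' * h t t')).
apply: eq_expect => f; rewrite -(expect_marginal j).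
by apply: eq_expect => f'; rewrite !ffunE !inE eqxx (negPf ij).
Qed.

Lemma prob_ge0 E : 0 <= prob E.
Proof. by apply: sumr_ge0 => f _; rewrite mulr_ge0 ?weight_ge0 ?ler0n. Qed.

Lemma prob_le1 E : prob E <= 1.
Proof.
rewrite -[leRHS](expect_cst 1); apply: le_expect => f.
by case: (E f); rewrite ?ler01.
Qed.

Lemma le_prob (E F : pred {ffun I -> T}) : (forall f, E f -> F f) -> prob E <= prob F.
Proof. by move=> EF; apply: le_expect => f; case Ef: (E f); rewrite ?(EF _ Ef) // ler0n. Qed.

Lemma prob_or (E F G : pred {ffun I -> T}) :
  (forall f, E f -> F f || G f) -> prob E <= prob F + prob G.
Proof.
move=> EFG; rewrite /prob /expect -big_split; apply: ler_sum => f _ /=.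
rewrite -mulrDr ler_wpM2l ?weight_ge0 // -natrD ler_nat.
by case Ef: (E f) => //; move: (EFG _ Ef); case: (F f); case: (G f).
Qed.

Lemma prob_union (J : finType) (Q : pred J) (E : pred {ffun I -> T})
    (F : J -> pred {ffun I -> T}) :
  (forall f, E f -> exists2 j, Q j & F j f) ->
  prob E <= \sum_(j | Q j) prob (F j).
Proof.
move=> EF; rewrite /prob -expect_sum; apply: le_expect => f.
case Ef: (E f); last by apply: sumr_ge0 => j _; rewrite ler0n.
have [j Qj Fj] := EF _ Ef.
by rewrite (bigD1 j) //= Fj lerDl sumr_ge0 // => k _; rewrite ler0n.
Qed.

Lemma markov (E : pred {ffun I -> T}) (g : {ffun I -> T} -> R) (c : R) :
  0 < c -> (forall f, 0 <= g f) -> (forall f, E f -> c <= g f) ->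
  prob E <= expect g / c.
Proof.
move=> c0 g0 Eg; rewrite ler_pdivlMr // mulrC /prob -expectZ.
apply: le_expect => f; case Ef: (E f); first by rewrite mulr1 Eg.
by rewrite mulr0.
Qed.

End ProductMeasure.

(* The only properties of the exponential that are used are its functional
   equation and its tangent at 0. *)
Section Chernoff.
Import ring lra Order.TTheory GRing.Theory Num.Theory.
Local Open Scope ring_scope.
Variables (R : realFieldType) (expo : R -> R).
Hypothesis expoD : forall x y, expo (x + y) = expo x * expo y.
Hypothesis expo_ge1D : forall x, 1 + x <= expo x.

Lemma expo0 : expo 0 = 1.
Proof.
have h := expoD 0 0; rewrite addr0 in h.
have z : expo 0 != 0.
  by apply/lt0r_neq0/(lt_le_trans ltr01)/(le_trans _ (expo_ge1D 0)); rewrite addr0.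
by apply: (mulfI z); rewrite mulr1 -h.
Qed.

Lemma expoK x : expo x * expo (- x) = 1.
Proof. by rewrite -expoD subrr expo0. Qed.

Lemma expo_gt0 x : 0 < expo x.
Proof.
have h : expo x = expo (x / 2) * expo (x / 2) by rewrite -expoD; congr expo; lra.
have := expoK x; rewrite h; set u := expo (x / 2) => e.
rewrite lt_def -expr2 sqr_ge0 andbT sqrf_eq0.
by apply: contra_eq_neq e => ->; rewrite !mul0r eq_sym oner_eq0.
Qed.

Lemma expo_le x y : x <= y -> expo x <= expo y.
Proof.
move=> xy; have -> : y = x + (y - x) by lra.
rewrite expoD ler_peMr ?(ltW (expo_gt0 x)) //.
have := expo_ge1D (y - x); lra.
Qed.

Lemma expo_sum (J : Type) (r : seq J) (Q : pred J) (a : J -> R) :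
  expo (\sum_(j <- r | Q j) a j) = \prod_(j <- r | Q j) expo (a j).
Proof. exact: (big_morph expo expoD expo0). Qed.

(** The tangent at 0 also bounds from above: [expo y * (1 - y)] is at most [expo y * expo (- y)],
    which is 1, and (1 + y + 2y^2)(1 - y) = 1 + y^2 (1 - 2y) is at least 1 for y <= 1/2. *)
Lemma expo_le_quad y : - (1/2) <= y <= 1/2 -> expo y <= 1 + y + 2 * y ^+ 2.
Proof.
move=> /andP[y1 y2]; have h := expoK y; have g := expo_ge1D (- y).
have p := expo_gt0 y; rewrite expr2.
have h1 : expo y * (1 - y) <= 1 by rewrite -[leRHS]h ler_wpM2l // ltW.
have h2 : 1 <= (1 + y + 2 * (y * y)) * (1 - y).
  have y2' : 0 <= 1 - 2 * y by lra.
  have := mulr_ge0 (sqr_ge0 y) y2'; rewrite expr2; lra.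
have y3 : 0 < 1 - y by lra.
by rewrite -(ler_pM2r y3); lra.
Qed.

Variables (I T : finType) (mu : T -> R).
Hypothesis mu_ge0 : forall t, 0 <= mu t.
Hypothesis mu_sum1 : \sum_t mu t = 1.
Local Notation Pr := (prob (I := I) mu).

(** Markov's inequality for the exponential of the sum, whose moment factors by independence. The
    summands may vary with the coordinate because attributes later carry different weights. *)
Lemma chernoff (a : I -> T -> R) (b : I -> R) z :
  (forall i, \sum_t mu t * expo (a i t) <= 1 + b i) ->
  Pr (fun f => z <= \sum_i a i (f i)) <= expo (\sum_i b i - z).
Proof.
move=> hab.
apply: (le_trans (markov mu_ge0 (c := expo z) (g := fun f => \prod_i expo (a i (f i))) _ _ _)).
- exact: expo_gt0.
- by move=> f; apply: prodr_ge0 => i _; apply/ltW/expo_gt0.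
- by move=> f zf; rewrite -expo_sum expo_le.
rewrite (expect_prod mu (fun i t => expo (a i t))) (expoD _ (- z)).
have -> : expo (- z) = (expo z)^-1.
  have ez := expoK z; have z0 := expo_gt0 z.
  by apply: (mulfI (lt0r_neq0 z0)); rewrite ez mulfV ?lt0r_neq0.
rewrite ler_pM2r ?invr_gt0 ?expo_gt0 // expo_sum.
apply: ler_prod => i _; rewrite sumr_ge0 /=; last first.
  by move=> t _; rewrite mulr_ge0 // ltW // expo_gt0.
by rewrite (le_trans (hab i)) // expo_ge1D.
Qed.

Variable Q : pred T.
Let q := \sum_(t | Q t) mu t.
Definition count_coords (f : {ffun I -> T}) : nat := #|[set i | Q (f i)]|.

Lemma mgf_ind c : \sum_t mu t * expo (c * (Q t)%:R) = 1 + q * (expo c - 1).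
Proof.
transitivity (\sum_t (mu t + (if Q t then mu t else 0) * (expo c - 1))).
  apply: eq_bigr => t _; case: (Q t); rewrite ?mulr1 ?mulr0 ?expo0; lra.
by rewrite big_split /= mu_sum1 -mulr_suml -big_mkcond.
Qed.

Lemma sum_ind (c : R) (f : {ffun I -> T}) :
  \sum_i c * (Q (f i))%:R = c * (count_coords f)%:R.
Proof.
rewrite -mulr_sumr -natr_sum -big_mkcond sum1_card; congr (_ * _%:R).
by apply: eq_card => i; rewrite inE.
Qed.

Lemma count_coords_upper (eta : R) : 0 <= eta <= 2 ->
  Pr (fun f => (1 + eta) * (#|I|%:R * q) <= (count_coords f)%:R)
    <= expo (- (#|I|%:R * q * eta ^+ 2 / 8)).
Proof.
move=> /andP[e0 e2]; set nq := _ * q.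
(* This tilt minimises 2y^2 - eta y, with value -eta^2/8; eta <= 2 keeps y in the range of
   [expo_le_quad]. *)
pose y := eta / 4.
have q0 : 0 <= q by apply: sumr_ge0.
apply: (le_trans (le_prob mu_ge0 (F := fun f =>
  y * ((1 + eta) * nq) <= \sum_i y * (Q (f i))%:R) _)).
  by move=> f h; rewrite sum_ind ler_wpM2l // /y; lra.
apply: (le_trans (chernoff (a := fun _ t => y * (Q t)%:R) (b := fun=> q * (expo y - 1)) _ _)).
  by move=> i; rewrite mgf_ind.
rewrite sumr_const; apply: expo_le.
have h : expo y <= 1 + y + 2 * y ^+ 2 by apply: expo_le_quad; rewrite /y; lra.
rewrite -[_ *+ _]mulr_natl mulrA -/nq.
have nq0 : 0 <= nq by rewrite mulr_ge0.
have : nq * (expo y - 1) <= nq * (y + 2 * y ^+ 2) by rewrite ler_wpM2l //; lra.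
rewrite /y; lra.
Qed.

Lemma count_coords_lower (eta : R) : 0 <= eta <= 2 ->
  Pr (fun f => (count_coords f)%:R <= (1 - eta) * (#|I|%:R * q))
    <= expo (- (#|I|%:R * q * eta ^+ 2 / 8)).
Proof.
move=> /andP[e0 e2]; set nq := _ * q.
pose y := - (eta / 4).
have q0 : 0 <= q by apply: sumr_ge0.
apply: (le_trans (le_prob mu_ge0 (F := fun f =>
  y * ((1 - eta) * nq) <= \sum_i y * (Q (f i))%:R) _)).
  by move=> f h; rewrite sum_ind ler_wnM2l // /y; lra.
apply: (le_trans (chernoff (a := fun _ t => y * (Q t)%:R) (b := fun=> q * (expo y - 1)) _ _)).
  by move=> i; rewrite mgf_ind.
rewrite sumr_const; apply: expo_le.
have h : expo y <= 1 + y + 2 * y ^+ 2 by apply: expo_le_quad; rewrite /y; lra.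
rewrite -[_ *+ _]mulr_natl mulrA -/nq.
have nq0 : 0 <= nq by rewrite mulr_ge0.
have : nq * (expo y - 1) <= nq * (y + 2 * y ^+ 2) by rewrite ler_wpM2l //; lra.
rewrite /y; lra.
Qed.

End Chernoff.

(** * Uniform random subsets versus Bernoulli subsets *)

Section RandomSubsets.
Import ring lra Order.TTheory GRing.Theory Num.Theory.
Local Open Scope ring_scope.
Variables (R : realFieldType) (m : nat).
Implicit Types (E : pred {set 'I_m}) (S : {set 'I_m}).

Definition freq E (k : nat) : R :=
  #|[set S : {set 'I_m} | E S & #|S| == k]|%:R / 'C(m, k)%:R.

Lemma card_lt_ordS S : (#|S| < m.+1)%N.
Proof. by rewrite ltnS -[leqRHS]card_ord max_card. Qed.

Lemma card_setC_ord S : #|~: S| = (m - #|S|)%N.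
Proof. by rewrite [LHS]cardsCs setCK card_ord. Qed.

Lemma sum_by_card E (F : nat -> R) :
  \sum_(S : {set 'I_m}) F #|S| * (E S)%:R = \sum_(k < m.+1) F k * 'C(m, k)%:R * freq E k.
Proof.
rewrite (partition_big (fun S : {set 'I_m} => Ordinal (card_lt_ordS S)) predT) //=.
apply: eq_bigr => k _.
have -> : F k * 'C(m, k)%:R * freq E k =
    F k * #|[set S : {set 'I_m} | E S & #|S| == k]|%:R.
  rewrite /freq mulrA -(mulrA (F k)) (mulrC _%:R) mulrA mulfK // pnatr_eq0.
  by rewrite -lt0n bin_gt0 -ltnS ltn_ord.
rewrite -sum1_card natr_sum mulr_sumr big_mkcond [RHS]big_mkcond /=.
apply: eq_bigr => S _; rewrite inE.
have -> : (Ordinal (card_lt_ordS S) == k) = (#|S| == k) by [].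
case: eqP => [->|_]; last by rewrite andbF.
by rewrite andbT; case: (E S); rewrite ?mulr1 ?mulr0.
Qed.

Lemma freq_ge0 E k : 0 <= freq E k.
Proof. by rewrite mulr_ge0 ?invr_ge0 ?ler0n. Qed.

Lemma freqT k : (k <= m)%N -> freq predT k = 1.
Proof.
move=> km; rewrite /freq -[m in 'C(m, k)]card_ord -card_draws divff //.
by rewrite pnatr_eq0 card_draws card_ord -lt0n bin_gt0.
Qed.

Lemma freq_le1 E k : (k <= m)%N -> freq E k <= 1.
Proof.
move=> km; rewrite -(freqT km) ler_wpM2r ?invr_ge0 ?ler0n // ler_nat.
by apply: subset_leq_card; apply/subsetP => S; rewrite !inE => /andP[].
Qed.

Lemma freq_disjoint (A : {set 'I_m}) k :
  freq (fun S => S :&: A == set0) k = 'C(m - #|A|, k)%:R / 'C(m, k)%:R.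
Proof.
rewrite /freq; congr (_%:R / _).
rewrite -card_setC_ord -cards_draws; apply: eq_card => S; rewrite !inE.
by rewrite setI_eq0 disjoints_subset.
Qed.

(** Double counting: sending a pair (S, w) with w outside S to S with w added, together with w, is
    injective and stays in the increasing family. The identity (k+1) C(m,k+1) = (m-k) C(m,k) turns
    the counts into proportions. *)
Lemma freq_leS E k : (forall S S', S \subset S' -> E S -> E S') -> (k < m)%N ->
  freq E k <= freq E k.+1.
Proof.
move=> incE km.
have C0 j : (j <= m)%N -> (0 : R) < 'C(m, j)%:R by move=> jm; rewrite ltr0n bin_gt0.
have key : (#|[set S | E S & #|S| == k]| * (m - k) <=
            #|[set S | E S & #|S| == k.+1]| * k.+1)%N.
  pose X := [set S | E S & #|S| == k]; pose Y := [set S | E S & #|S| == k.+1].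
  have -> : (#|X| * (m - k))%N = (\sum_(S in X) \sum_(w | w \notin S) 1)%N.
    rewrite -sum_nat_const; apply: eq_bigr => S; rewrite inE => /andP[_ /eqP <-].
    by rewrite sum1_card -card_setC_ord; apply: eq_card => w; rewrite !inE.
  have -> : (#|Y| * k.+1)%N = (\sum_(S in Y) \sum_(w in S) 1)%N.
    rewrite -sum_nat_const; apply: eq_bigr => S; rewrite inE => /andP[_ /eqP <-].
    by rewrite sum1_card.
  rewrite !pair_big_dep !sum1_card /=.
  pose h (u : {set 'I_m} * 'I_m) := (u.2 |: u.1, u.2).
  rewrite -(card_in_imset (f := h)); last first.
    move=> [S w] [S' w'] /andP[_ /= wS] /andP[_ /= wS'] [e ew].
    by subst w'; congr (_, _); rewrite -(setU1K wS) e setU1K.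
  apply: subset_leq_card; apply/subsetP => _ /imsetP[[S w] /andP[/= + wS] ->].
  rewrite inE => /andP[ES /eqP cS]; apply/andP; split; last exact: setU11.
  rewrite inE /= cardsU1 wS cS eqxx andbT.
  by apply: incE ES; apply: subsetUr.
rewrite ler_pdivrMr ?C0 1?ltnW // mulrAC ler_pdivlMr ?C0 //.
rewrite -!natrM ler_nat -(leq_pmul2r (ltn0Sn k)) -mulnA (mulnC 'C(m, k.+1)).
by rewrite mul_bin_left mulnA [leqRHS]mulnAC leq_mul2r key orbT.
Qed.

Lemma freq_le E j k : (forall S S', S \subset S' -> E S -> E S') ->
  (j <= k <= m)%N -> freq E j <= freq E k.
Proof.
move=> incE /andP[]; elim: k => [|k IH] jk km.
  by move: jk; rewrite leqn0 => /eqP ->.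
move: jk; rewrite leq_eqVlt => /orP[/eqP -> //|jk].
by apply: le_trans (IH _ _) (freq_leS incE km); rewrite // ltnW.
Qed.

Definition bern (p : R) (b : bool) : R := if b then p else 1 - p.
(** The random subset is drawn as its indicator function, so that the product-measure results apply
    with the attributes as coordinates. *)
Definition bern_prob p E : R :=
  prob (bern p) (fun f : {ffun 'I_m -> bool} => E [set w | f w]).

Lemma bern_ge0 p b : 0 <= p <= 1 -> 0 <= bern p b.
Proof. by move=> /andP[p0 p1]; rewrite /bern; case: b => /=; lra. Qed.

Lemma bern_sum1 p : \sum_b bern p b = 1.
Proof. by rewrite big_bool /bern /=; lra. Qed.

Lemma bern_probE p E :
  bern_prob p E = \sum_(S : {set 'I_m}) (p ^+ #|S| * (1 - p) ^+ (m - #|S|)) * (E S)%:R.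
Proof.
rewrite /bern_prob /prob /expect.
rewrite (reindex (fun S : {set 'I_m} => [ffun w => w \in S])) /=; last first.
  exists (fun f : {ffun _ -> bool} => [set w | f w]).
    by move=> S _; apply/setP => w; rewrite inE ffunE.
  by move=> f _; apply/ffunP => w; rewrite ffunE inE.
apply: eq_bigr => S _.
have -> : [set w | [ffun w0 => w0 \in S] w] = S by apply/setP => w; rewrite inE ffunE.
congr (_ * _); rewrite /weight (bigID (mem S)) /=; congr (_ * _).
  rewrite (eq_bigr (fun=> p)); last by move=> w wS; rewrite ffunE wS.
  by rewrite prodr_const.
rewrite (eq_bigr (fun=> 1 - p)); last by move=> w wS; rewrite ffunE (negPf wS).
rewrite prodr_const; congr (_ ^+ _).
by rewrite -card_setC_ord; apply: eq_card => w; rewrite !inE.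
Qed.

Lemma bern_prob_freq p E : bern_prob p E =
  \sum_(k < m.+1) p ^+ k * (1 - p) ^+ (m - k) * 'C(m, k)%:R * freq E k.
Proof. by rewrite bern_probE (sum_by_card E (fun k => p ^+ k * (1 - p) ^+ (m - k))). Qed.

Lemma freqC E k : (k <= m)%N -> freq E k + freq (predC E) k = 1.
Proof.
move=> km; rewrite -(freqT km) /freq -mulrDl -natrD; congr (_%:R / _).
rewrite -cardsUI.
have -> : [set S | E S & #|S| == k] :&: [set S | predC E S & #|S| == k] = set0.
  by apply/setP => S; rewrite !inE; case: (E S); rewrite ?andbF.
rewrite cards0 addn0; apply: eq_card => S; rewrite !inE.
by case: (E S); case: eqP.
Qed.

(** With denominators restored, C(m-a,b)/C(m,b) is a product of factors (m-a-j)/(m-j), each at most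
    (m-a)/m: the cross products differ by aj. *)
Lemma leq_bin_expn a b : (a <= m)%N -> ('C(m - a, b) * m ^ b <= (m - a) ^ b * 'C(m, b))%N.
Proof.
move=> am; elim: b => [|b IH]; first by rewrite !bin0 !expn0.
have [bm|mb] := leqP (a + b) m; last first.
  by rewrite bin_small // ltn_subLR // ltnW // addnS ltnS.
rewrite -(leq_pmul2l (ltn0Sn b)) mulnA mul_bin_left mulnCA mul_bin_left.
have -> : ((m - a - b) * 'C(m - a, b) * m ^ b.+1 =
           ('C(m - a, b) * m ^ b) * ((m - a - b) * m))%N by rewrite expnSr; ring.
have -> : ((m - a) ^ b.+1 * ((m - b) * 'C(m, b)) =
           ((m - a) ^ b * 'C(m, b)) * ((m - a) * (m - b)))%N by rewrite expnSr; ring.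
apply: leq_mul => //.
have [c ->] : exists c, m = (a + b + c)%N by exists (m - (a + b))%N; rewrite subnKC.
have -> : (a + b + c - a - b = c)%N by rewrite -subnDA addKn.
have -> : (a + b + c - a = b + c)%N by rewrite -addnA addKn.
have -> : (a + b + c - b = a + c)%N by rewrite (addnC a) -addnA addKn.
rewrite -(leq_add2r 0) !addn0.
have -> : ((b + c) * (a + c) = c * (a + b + c) + a * b)%N by ring.
exact: leq_addr.
Qed.

Variable P : nat -> R.
Hypothesis P_ge0 : forall k, (k <= m)%N -> 0 <= P k.
Hypothesis P_sum1 : \sum_(k < m.+1) P k = 1.

Definition law S : R := P #|S| / 'C(m, #|S|)%:R.

Lemma sum_law (Q : pred nat) E :
  \sum_(S : {set 'I_m}) law S * (Q #|S| && E S)%:R = \sum_(k < m.+1 | Q k) P k * freq E k.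
Proof.
rewrite [RHS]big_mkcond (eq_bigr (fun S : {set 'I_m} =>
  (P #|S| / 'C(m, #|S|)%:R * (Q #|S|)%:R) * (E S)%:R)); last first.
  by move=> S _; rewrite -mulrA -natrM mulnb.
rewrite (sum_by_card _ (fun k => P k / 'C(m, k)%:R * (Q k)%:R)).
apply: eq_bigr => k _; case: (Q k); last by rewrite mulr0 !mul0r.
rewrite mulr1 divfK // pnatr_eq0 -lt0n bin_gt0 -ltnS.
exact: ltn_ord.
Qed.

Lemma law_ge0 S : 0 <= law S.
Proof. by rewrite mulr_ge0 ?invr_ge0 ?ler0n // P_ge0 // -ltnS card_lt_ordS. Qed.

Lemma sum_law_card (Q : pred nat) :
  \sum_(S : {set 'I_m} | Q #|S|) law S = \sum_(k < m.+1 | Q k) P k.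
Proof.
have := sum_law Q predT; rewrite [in RHS](eq_bigr (fun k : 'I_m.+1 => P k)).
  move=> <-; rewrite big_mkcond; apply: eq_bigr => S _.
  by case: (Q _); rewrite ?mulr1 ?mulr0.
by move=> k _; rewrite freqT ?mulr1 // -ltnS.
Qed.

Lemma law_sum1 : \sum_(S : {set 'I_m}) law S = 1.
Proof. by rewrite (sum_law_card xpredT). Qed.

(* For increasing [E], [freq E k] is nondecreasing in [k], so the [k]-subsets with
   [k <= s] are dominated by the [s]-subsets and these by a Bernoulli subset
   conditioned to have size at least [s]. *)
Lemma law_le_bern E p s : (forall S S', S \subset S' -> E S -> E S') ->
  0 <= p <= 1 -> 1 / 2 <= bern_prob p (fun S => s <= #|S|)%N ->
  \sum_(S : {set 'I_m}) law S * ((#|S| <= s)%N && E S)%:R <= 2 * bern_prob p E.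
Proof.
move=> incE /andP[p0 p1] hs.
pose B k : R := p ^+ k * (1 - p) ^+ (m - k) * 'C(m, k)%:R.
have B0 k : 0 <= B k by rewrite !mulr_ge0 ?exprn_ge0 //; lra.
have sm : (s <= m)%N.
  rewrite leqNgt; apply/negP => ms; move: hs.
  rewrite bern_probE big1 => [|S _]; first by lra.
  by rewrite leqNgt (leq_trans (card_lt_ordS S)) ?mulr0.
rewrite (sum_law (fun k => k <= s)%N).
have h1 : \sum_(k < m.+1 | (k <= s)%N) P k * freq E k <= freq E s.
  rewrite -[leRHS]mul1r -P_sum1 mulr_suml big_mkcond; apply: ler_sum => k _.
  have km : (k <= m)%N by rewrite -ltnS.
  case: ifP => ks; last by rewrite mulr_ge0 ?P_ge0 ?freq_ge0.
  by rewrite ler_wpM2l ?P_ge0 // freq_le ?ks.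
have h2 : freq E s * (1 / 2) <= bern_prob p E.
  apply: le_trans (_ : freq E s * bern_prob p (fun S => s <= #|S|)%N <= _).
    by rewrite ler_wpM2l ?freq_ge0.
  rewrite !bern_prob_freq mulr_sumr; apply: ler_sum => k _; rewrite -/(B k).
  have km : (k <= m)%N by rewrite -ltnS.
  rewrite mulrCA ler_wpM2l //; have [sk|ks] := leqP s k.
    rewrite (le_trans (_ : _ <= freq E s)) ?freq_le ?sk //.
    by rewrite ler_piMr ?freq_ge0 ?freq_le1.
  rewrite [X in _ * X](_ : _ = 0) ?mulr0 ?freq_ge0 // /freq.
  rewrite (_ : [set _ | _] = set0) ?cards0 ?mul0r //; apply/setP => S.
  by rewrite !inE; apply/negP => /andP[+ /eqP e]; rewrite e leqNgt ks.
lra.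
Qed.

(** Through the complement: a k-subset misses w with probability C(m-1,k)/C(m,k) = 1 - k/m. *)
Lemma law_mem w : \sum_(S : {set 'I_m}) law S * (w \in S)%:R =
  (\sum_(k < m.+1) P k * k%:R) / m%:R.
Proof.
have m0 : (0 < m)%N by case: m w => // -[].
rewrite (sum_law predT (fun S => w \in S)) mulr_suml; apply: eq_bigr => k _.
have km : (k <= m)%N by rewrite -ltnS.
rewrite -mulrA; congr (_ * _).
have := freqC (fun S => w \in S) km.
have -> : freq (predC (fun S => w \in S)) k = freq (fun S => S :&: [set w] == set0) k.
  rewrite /freq; congr (_%:R / _); apply: eq_card => S; rewrite !inE; congr (_ && _).
  by rewrite setI_eq0 disjoint_sym disjoints1.
rewrite freq_disjoint cards1 subn1 => e.
have C0 : 'C(m, k)%:R != 0 :> R by rewrite pnatr_eq0 -lt0n bin_gt0.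
have m0' : m%:R != 0 :> R by rewrite pnatr_eq0 -lt0n.
have := mul_bin_down m k => /(congr1 (fun x => x%:R : R)).
rewrite !natrM natrB // => e2.
have -> : freq (fun S => w \in S) k = 1 - 'C(m.-1, k)%:R / 'C(m, k)%:R by lra.
apply: (mulIf m0'); apply: (mulIf C0); rewrite divfK // mulrBl mul1r mulrBl.
have -> : 'C(m.-1, k)%:R / 'C(m, k)%:R * m%:R * 'C(m, k)%:R = m%:R * 'C(m.-1, k)%:R :> R.
  by rewrite -mulrA mulrAC -mulrA mulrA mulrC; field.
rewrite e2; ring.
Qed.

Variable expo : R -> R.
Hypothesis expoD : forall x y, expo (x + y) = expo x * expo y.
Hypothesis expo_ge1D : forall x, 1 + x <= expo x.

Lemma expoM_nat x k : expo (x * k%:R) = expo x ^+ k.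
Proof.
elim: k => [|k IH]; first by rewrite mulr0 expr0 (expo0 expoD expo_ge1D).
by rewrite -natr1 mulrDr mulr1 expoD IH exprSr.
Qed.

(** C(m-|A|,k)/C(m,k) <= (1 - |A|/m)^k <= exp(-|A|k/m), and both |A| and k are at least s. With s^2
    = tau m ln n this is n^(-tau). *)
Lemma freq_disjoint_le (A : {set 'I_m}) k s : (s <= #|A|)%N -> (s <= k <= m)%N ->
  freq (fun S => S :&: A == set0) k <= expo (- (s%:R ^+ 2 / m%:R)).
Proof.
move=> sA /andP[sk km].
have [m0|m0] := posnP m.
  have s0 : s = 0%N by apply/eqP; rewrite -leqn0 -m0 (leq_trans sk).
  by rewrite s0 expr0n mul0r oppr0 (expo0 expoD expo_ge1D) freq_le1.
have Am : (#|A| <= m)%N by rewrite -ltnS card_lt_ordS.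
have m0' : 0 < m%:R :> R by rewrite ltr0n.
have C0 : 0 < 'C(m, k)%:R :> R by rewrite ltr0n bin_gt0.
rewrite freq_disjoint.
apply: (@le_trans _ _ ((1 - #|A|%:R / m%:R) ^+ k)).
  rewrite ler_pdivrMr // -(ler_pM2r (exprn_gt0 k m0')) mulrAC -exprMn.
  have -> : (1 - #|A|%:R / m%:R) * m%:R = (m - #|A|)%:R :> R.
    by rewrite mulrBl mul1r divfK ?natrB // gt_eqF.
  by rewrite -!natrX -!natrM ler_nat leq_bin_expn.
apply: (@le_trans _ _ (expo (- (#|A|%:R / m%:R)) ^+ k)).
  have : 1 - #|A|%:R / m%:R <= expo (- (#|A|%:R / m%:R)) by exact: expo_ge1D.
  have : 0 <= 1 - #|A|%:R / m%:R :> R.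
    by rewrite subr_ge0 ler_pdivrMr // mul1r ler_nat.
  by move=> h1 h2; rewrite lerXn2r // nnegrE // (le_trans h1).
rewrite -expoM_nat; apply: (expo_le expoD expo_ge1D).
rewrite mulNr lerN2 [leRHS]mulrAC; apply: ler_wpM2r; first by rewrite invr_ge0 ler0n.
by rewrite -natrX -natrM ler_nat leq_mul.
Qed.

Lemma law_disjoint_le (A : {set 'I_m}) s : (s <= #|A|)%N ->
  \sum_(S : {set 'I_m}) law S * ((s <= #|S|)%N && (S :&: A == set0))%:R <=
  (\sum_(k < m.+1 | (s <= k)%N) P k) * expo (- (s%:R ^+ 2 / m%:R)).
Proof.
move=> sA; rewrite (sum_law (fun k => s <= k)%N (fun S => S :&: A == set0)).
rewrite mulr_suml; apply: ler_sum => k sk.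
have km : (k <= m)%N by rewrite -ltnS.
by rewrite ler_wpM2l ?P_ge0 // freq_disjoint_le // sk.
Qed.

End RandomSubsets.

(** * Hitting all sets of a family with one Bernoulli subset *)

Section HitAll.
Import ring lra Order.TTheory GRing.Theory Num.Theory.
Local Open Scope ring_scope.
Variables (R : realFieldType) (expo : R -> R).
Hypothesis expoD : forall x y, expo (x + y) = expo x * expo y.
Hypothesis expo_ge1D : forall x, 1 + x <= expo x.
Variables (m : nat) (p : R).
Hypothesis p01 : 0 <= p <= 1.
Implicit Type S : {set 'I_m}.

Let b0 b : 0 <= bern p b. Proof. exact: bern_ge0. Qed.
Let b1 : \sum_b bern p b = 1. Proof. exact: bern_sum1. Qed.

(** For c in [0, 1/2] the quadratic bound gives exp(c) <= 1 + 2c, so an attribute of weight c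
    contributes a factor at most 1 + 2pc. *)
Lemma bern_chernoff (c : 'I_m -> R) z : (forall w, 0 <= c w <= 1 / 2) ->
  bern_prob p (fun S => z <= \sum_w c w * (w \in S)%:R) <= expo (2 * p * \sum_w c w - z).
Proof.
move=> c01; rewrite mulr_sumr /bern_prob.
apply: (@le_trans _ _ (prob (bern p) (fun f : {ffun 'I_m -> bool} =>
    z <= \sum_w c w * (f w)%:R))).
  by apply: (le_prob b0) => f; under eq_bigr do rewrite inE.
apply: (chernoff expoD expo_ge1D b0 (a := fun w b => c w * b%:R) (b := fun w => 2 * p * c w)) => w.
have [p0 p1] := andP p01.
rewrite big_bool /= /bern mulr1 mulr0 (expo0 expoD expo_ge1D) mulr1.
have /andP[c0 c1] := c01 w.
have h := expo_le_quad expoD expo_ge1D (y := c w).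
have {h}h : expo (c w) <= 1 + 2 * c w.
  apply: le_trans (h _) _; first by lra.
  by rewrite expr2; have := ler_wpM2l c0 c1; lra.
have := ler_wpM2l p0 h; lra.
Qed.

Lemma bern_miss (U : {set 'I_m}) :
  bern_prob p (fun S => S :&: U == set0) = (1 - p) ^+ #|U|.
Proof.
rewrite /bern_prob /prob (eq_expect _ (h := fun f : {ffun 'I_m -> bool} =>
  \prod_w (if (w \in U) && f w then 0 else 1))); last first.
  move=> f; case: eqP => [e|/eqP].
    rewrite big1 // => w _; case: ifP => // /andP[wU fw].
    by have := in_set0 w; rewrite -e !inE fw wU.
  case/set0Pn => w; rewrite !inE => /andP[fw wU].
  by rewrite (bigD1 w) //= wU fw mul0r.
rewrite (expect_prod (bern p) (fun w b => if (w \in U) && b then 0 else 1)).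
rewrite (bigID (mem U)) /= [X in _ * X]big1; last first.
  by move=> w /negPf wU; rewrite big_bool /= wU /= /bern; lra.
rewrite mulr1 (eq_bigr (fun=> 1 - p)) ?prodr_const // => w wU.
by rewrite big_bool /= wU /= /bern; lra.
Qed.

(** Hits of disjoint sets are independent, and each set is hit with probability at most 1 - (1-p)^s
    <= exp(-(1-p)^s). The induction splits off one set and resamples its attributes. *)
Lemma bern_hit_disjoint (V : finType) (J : {set V}) (U : V -> {set 'I_m}) s :
  (forall v, v \in J -> #|U v| <= s)%N ->
  (forall u v, u \in J -> v \in J -> u != v -> [disjoint U u & U v]) ->
  bern_prob p (fun S => [forall v in J, S :&: U v != set0])
    <= expo (- ((1 - p) ^+ s * #|J|%:R)).
Proof.
have [p0 p1] := andP p01.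
elim: {J}#|J| {-2}J (erefl #|J|) => [|k IH] J cJ Us Ud; rewrite cJ.
  rewrite mulr0 oppr0 (expo0 expoD expo_ge1D); exact: prob_le1.
have [v0 v0J] : exists v, v \in J by apply/set0Pn; rewrite -card_gt0 cJ.
have cJ' : #|J :\ v0| = k by apply/eqP; rewrite -eqSS -cJ (cardsD1 v0 J) v0J.
have sJ v : v \in J :\ v0 -> v \in J by rewrite !inE => /andP[].
have {}IH := IH _ cJ' (fun v vJ => Us v (sJ v vJ))
  (fun u v uJ vJ => Ud u v (sJ u uJ) (sJ v vJ)).
pose hit (f : {ffun 'I_m -> bool}) v := [set w | f w] :&: U v != set0.
have miss : prob (bern p) (fun f => hit f v0) <= expo (- (1 - p) ^+ s).
  have e : prob (bern p) (fun f => hit f v0) = 1 - (1 - p) ^+ #|U v0|.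
    rewrite -bern_miss /bern_prob; apply/eqP; rewrite eq_sym subr_eq; apply/eqP.
    rewrite -[LHS](expect_cst 'I_m b1) /prob /expect -big_split.
    apply: eq_bigr => f _ /=; rewrite -mulrDr /hit.
    by case: eqP => _; rewrite ?add0r ?addr0.
  rewrite e (le_trans _ (expo_ge1D _)) // lerD2l lerN2.
  by apply: ler_wiXn2l; rewrite ?Us //; lra.
(* After resampling [U v0], the other sets see only f, while [U v0] sees only f'. *)
have h f f' : [forall v in J, hit (splice (U v0) f f') v] ->
    [forall v in J :\ v0, hit f v] && hit f' v0.
  move=> /forall_inP H; apply/andP; split.
    apply/forall_inP => v; rewrite !inE => /andP[vv0 vJ].
    have /set0Pn[w] := H v vJ; rewrite !inE ffunE => /andP[+ wv].
    have := Ud v v0 vJ v0J vv0; rewrite disjoint_subset => /subsetP/(_ w wv).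
    rewrite inE /= => /negPf -> fw.
    by apply/set0Pn; exists w; rewrite !inE fw.
  have /set0Pn[w] := H v0 v0J; rewrite !inE ffunE => /andP[+ wv].
  by rewrite wv => fw; apply/set0Pn; exists w; rewrite !inE fw.
rewrite {1}/bern_prob /prob (expect_splice b1 (U v0)).
apply: (@le_trans _ _ (expect (bern p) (fun f => 
   [forall v in J :\ v0, hit f v]%:R * prob (bern p) (fun f => hit f v0)))).
  apply: (le_expect b0) => f; rewrite /prob -expectZ; apply: (le_expect b0) => f'.
  rewrite -natrM mulnb ler_nat -/(hit _ _).
  by case H: [forall v in J, _] => //; rewrite h.
rewrite (eq_expect _ (h := fun f => prob (bern p) (fun f0 => hit f0 v0) *
   [forall v in J :\ v0, hit f v]%:R)); last by move=> f; rewrite mulrC.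
rewrite expectZ -natr1 mulrDr mulr1 opprD expoD mulrC.
rewrite cJ' in IH; by apply: ler_pM => //; apply: (prob_ge0 b0).
Qed.

Variables (V : finType) (B : {set V}) (F : V -> {set 'I_m}) (s t D : nat).

Definition set_degree (w : 'I_m) : nat := #|[set v in B | w \in F v]|.

(** An attribute of degree d >= 2 satisfies d <= d(d-1), the number of ordered pairs of sets sharing
    it; summed over attributes, this counts the pairwise overlaps. *)
Lemma sum_degree_overlap :
  (forall u v, u \in B -> v \in B -> u != v -> #|F u :&: F v| <= t)%N ->
  (\sum_(w | 1 < set_degree w) set_degree w <= #|B| ^ 2 * t)%N.
Proof.
move=> Ht.
apply: (@leq_trans (\sum_(u in B) \sum_(v in B | u != v) #|F u :&: F v|)); last first.
  rewrite expnS expn1 -mulnA -sum_nat_const; apply: leq_sum => u uB.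
  rewrite -sum_nat_const big_mkcond [leqRHS]big_mkcond; apply: leq_sum => v _.
  by case: (boolP (v \in B)) => //= vB; case: ifP => // uv; apply: Ht.
have -> : (\sum_(u in B) \sum_(v in B | u != v) #|F u :&: F v| =
  \sum_w \sum_(u in B) \sum_(v in B | u != v) ((w \in F u) && (w \in F v)))%N.
  rewrite [RHS]exchange_big; apply: eq_bigr => u _.
  rewrite [RHS]exchange_big; apply: eq_bigr => v _.
  rewrite -sum1_card big_mkcond; apply: eq_bigr => w _.
  by rewrite inE; case: (_ && _).
rewrite big_mkcond; apply: leq_sum => w _; case: ifP => // dw.
rewrite [X in (X <= _)%N](_ : _ = \sum_(u in B) (w \in F u))%N; last first.
  rewrite /set_degree -sum1_card big_mkcond [RHS]big_mkcond.
  by apply: eq_bigr => u _; rewrite inE; case: (u \in B); case: (w \in F u).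
apply: leq_sum => u uB; case wu: (w \in F u) => //=.
have : (0 < #|[set v in B | w \in F v] :\ u|)%N.
  by move: dw; rewrite /set_degree (cardsD1 u) inE uB wu.
rewrite card_gt0 => /set0Pn[v]; rewrite !inE => /andP[vu /andP[vB wv]].
by rewrite (bigD1 v) /= ?vB 1?eq_sym // wv.
Qed.

(* Attributes lying in a single [F v] give disjoint sets, which are hit
   independently; [E1] is the unlikely event that the attributes shared by
   several [F v] account for half of the hits. *)
Lemma bern_hit_all :
  (forall v, v \in B -> #|F v| <= s)%N ->
  (forall u v, u \in B -> v \in B -> u != v -> #|F u :&: F v| <= t)%N ->
  (0 < D)%N -> (forall w, set_degree w <= D)%N ->
  bern_prob p (fun S => [forall v in B, S :&: F v != set0]) <=
  expo (p * (#|B|%:R ^+ 2 * t%:R) / D%:R - #|B|%:R / (4 * D%:R))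
  + expo (- ((1 - p) ^+ s * (#|B|%:R / 2))).
Proof.
move=> Hs Ht D0 HD; have [p0 p1] := andP p01.
have D0' : 0 < D%:R :> R by rewrite ltr0n.
pose T := [set w | 1 < set_degree w]%N.
(* The divisor 2D brings the weights into [0, 1/2], as [bern_chernoff] requires; [z] is then the
   weight of |B|/2 incidences between B and the shared attributes in S. *)
pose c w : R := if w \in T then (set_degree w)%:R / (2 * D%:R) else 0.
pose z : R := #|B|%:R / (4 * D%:R).
pose hits S := [forall v in B, S :&: F v != set0].
pose E1 S := z <= \sum_w c w * (w \in S)%:R.
have c01 w : 0 <= c w <= 1 / 2.
  rewrite /c; case: ifP => _; last by lra.
  rewrite divr_ge0 ?mulr_ge0 ?ler0n //= ler_pdivrMr ?mulr_gt0 //.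
  by rewrite mulrA divfK ?pnatr_eq0 // mul1r ler_nat.
have sumc : \sum_w c w <= #|B|%:R ^+ 2 * t%:R / (2 * D%:R).
  rewrite /c -big_mkcond -mulr_suml ler_wpM2r ?invr_ge0 ?mulr_ge0 ?ler0n //.
  rewrite -natr_sum -natrX -natrM ler_nat; apply: leq_trans (sum_degree_overlap Ht).
  by apply: eq_leq; apply: eq_bigl => w; rewrite inE.
have bE1 : bern_prob p E1 <= expo (p * (#|B|%:R ^+ 2 * t%:R) / D%:R - z).
  apply: le_trans (bern_chernoff z c01) _; apply: (expo_le expoD expo_ge1D).
  rewrite lerD2r -mulrA; apply: (@le_trans _ _
    (2 * (p * (#|B|%:R ^+ 2 * t%:R / (2 * D%:R))))).
    by rewrite ler_wpM2l ?ler0n // ler_wpM2l.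
  by rewrite le_eqVlt; apply/orP; left; apply/eqP; field; rewrite pnatr_eq0 -lt0n.
apply: (@le_trans _ _ (bern_prob p E1 + bern_prob p (fun S => hits S && ~~ E1 S))).
  by apply: (prob_or b0) => f hf; rewrite /hits hf; case: (E1 _).
apply: lerD => //.
(* [J f] collects the sets of B none of whose shared attributes was drawn. It depends on f only
   through T, so it stays fixed when the private attributes are resampled. *)
pose J (f : {ffun 'I_m -> bool}) :=
  [set v in B | [forall w in T :&: F v, ~~ f w]].
pose U v := F v :\: T.
rewrite /bern_prob /prob (expect_splice b1 (~: T)).
rewrite -[leRHS](expect_cst 'I_m b1); apply: (le_expect b0) => f.
(* If at least half of B lies in [J f], these sets have to be hit in their disjoint private parts.
   Otherwise the shared attributes hit more than half of B, so [E1] holds and the integrand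
   vanishes. *)
have [big|small] := leqP #|B| (2 * #|J f|).
  apply: (@le_trans _ _ (bern_prob p (fun S => [forall v in J f, S :&: U v != set0]))).
    apply: (le_prob b0) => f' /andP[/forall_inP H _]; apply/forall_inP => v.
    rewrite inE => /andP[vB /forall_inP vT].
    have /set0Pn[w] := H v vB; rewrite !inE ffunE inE => /andP[+ wv].
    case: (boolP (w \in T)) => wT /=; first by rewrite (negPf (vT w _)) // inE wT.
    by move=> fw; apply/set0Pn; exists w; rewrite !inE fw wv andbT; rewrite inE in wT.
  apply: le_trans (bern_hit_disjoint (s := s) _ _) _.
  - move=> v; rewrite inE => /andP[vB _].
    by rewrite (leq_trans _ (Hs v vB)) ?subset_leq_card ?subsetDl.
  - move=> u v; rewrite !inE => /andP[uB _] /andP[vB _] uv.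
    rewrite disjoint_subset; apply/subsetP => w; rewrite !inE => /andP[dw wu].
    apply/negP => /andP[_ wv]; case/negP: dw.
    rewrite /set_degree (cardsD1 u) inE uB wu ltnS card_gt0.
    by apply/set0Pn; exists v; rewrite !inE eq_sym uv vB wv.
  apply: (expo_le expoD expo_ge1D); rewrite lerN2 ler_wpM2l ?exprn_ge0 ?subr_ge0 //.
  by rewrite ler_pdivrMr // -natrM ler_nat mulnC.
rewrite (_ : expect _ _ = 0) ?(ltW (expo_gt0 expoD expo_ge1D _)) //.
apply: big1 => f' _; case: andP => [[_ /negP[]]|_]; last by rewrite mulr0.
rewrite /E1 /z; set S := [set w | _].
have lower : (#|B| <= 2 * \sum_(w in T) set_degree w * (f w))%N.
  have hB : (#|B :\: J f| <= \sum_(w in T) set_degree w * (f w))%N.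
    rewrite (@leq_trans (\sum_(v in B) \sum_(w in T) ((w \in F v) && f w))%N) //.
      rewrite -sum1_card big_mkcond [leqRHS]big_mkcond; apply: leq_sum => v _.
      rewrite !inE; case: (v \in B); rewrite /= ?andbF // andbT.
      case: forall_inP => //= /forall_inP; rewrite -negb_exists_in negbK => /exists_inP[w].
      by rewrite inE => /andP[wT wv] fw; rewrite (bigD1 w) //= wv fw.
    rewrite exchange_big; apply: leq_sum => w wT.
    case: (f w); last by rewrite muln0 big1 // => v _; rewrite andbF.
    rewrite muln1 /set_degree -sum1_card big_mkcond [leqRHS]big_mkcond.
    by apply: leq_sum => v _; rewrite inE andbT; case: (v \in B); case: (w \in F v).
  have := cardsID (J f) B; have -> : B :&: J f = J f.
    by apply/setIidPr/subsetP => v; rewrite inE => /andP[].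
  lia.
apply: (@le_trans _ _ ((\sum_(w in T) set_degree w * (f w))%:R / (2 * D%:R))).
  rewrite ler_pdivlMr ?mulr_gt0 //.
  rewrite (_ : #|B|%:R / (4 * D%:R) * (2 * D%:R) = #|B|%:R / 2); last first.
    by field; rewrite pnatr_eq0 -lt0n.
  by rewrite ler_pdivrMr // -natrM ler_nat mulnC.
rewrite natr_sum mulr_suml big_mkcond le_eqVlt; apply/orP; left; apply/eqP.
apply: eq_bigr => w _; rewrite /c; case: ifP => wT; last by rewrite mul0r.
by rewrite natrM !inE ffunE inE wT /= mulrAC.
Qed.

End HitAll.

(** * Cliques in a random intersection graph with fixed n and m *)

Section ProbAll.
Import ring lra Order.TTheory GRing.Theory Num.Theory.
Local Open Scope ring_scope.
Variables (R : realFieldType) (I T : finType) (mu : T -> R).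
Hypothesis mu_ge0 : forall t, 0 <= mu t.
Hypothesis mu_sum1 : \sum_t mu t = 1.

(* Once the coordinates on which [G] and [Phi] depend are fixed, the
   coordinates in [K] are independent. *)
Lemma prob_all_le (K : {set I}) (G : pred {ffun I -> T})
    (Phi : {ffun I -> T} -> pred T) (rho : R) : 0 <= rho ->
  (forall v f f', v \in K -> G (splice [set v] f f') = G f) ->
  (forall v f f' t, v \in K -> Phi (splice [set v] f f') t = Phi f t) ->
  (forall f, G f -> \sum_t mu t * (Phi f t)%:R <= rho) ->
  prob mu (fun f => G f && [forall v in K, Phi f (f v)]) <= rho ^+ #|K|.
Proof.
move=> rho0 GK PhiK Grho.
elim: {K}#|K| {-2}K (erefl #|K|) GK PhiK => [|k IH] K cK GK PhiK; rewrite cK.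
  by rewrite expr0; apply: (prob_le1 mu_ge0).
have [v0 v0K] : exists v, v \in K by apply/set0Pn; rewrite -card_gt0 cK.
have cK' : #|K :\ v0| = k by apply/eqP; rewrite -eqSS -cK (cardsD1 v0 K) v0K.
have sK v : v \in K :\ v0 -> v \in K by rewrite !inE => /andP[].
have {}IH := IH _ cK' (fun v f f' vK => GK v f f' (sK v vK))
  (fun v f f' t vK => PhiK v f f' t (sK v vK)).
rewrite /prob (expect_splice mu_sum1 [set v0]).
rewrite cK' in IH; rewrite exprS.
apply: (le_trans _ (ler_wpM2l rho0 IH)).
rewrite /prob -expectZ; apply: (le_expect mu_ge0) => f.
case: (boolP (G f && _)) => [/andP[Gf Hf]|nGf]; last first.
  rewrite mulr0 (_ : expect _ _ = 0) //; apply: big1 => f' _.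
  case: andP => [[Gs /forall_inP Hs]|_]; last by rewrite mulr0.
  case/negP: nGf; rewrite GK // in Gs; rewrite Gs; apply/forall_inP => v vK.
  have := Hs v (sK v vK); rewrite PhiK // ffunE inE.
  by move: vK; rewrite !inE => /andP[/negPf ->].
rewrite mulr1 (le_trans _ (Grho f Gf)) //.
rewrite -(expect_marginal mu_sum1 v0 (fun t => (Phi f t)%:R)).
apply: (le_expect mu_ge0) => f'; rewrite ler_nat.
case: andP => // -[_ /forall_inP Hs].
by have := Hs v0 v0K; rewrite PhiK // ffunE inE eqxx => ->.
Qed.

End ProbAll.

Lemma exists_subset_card (T : finType) (A : {set T}) i : i <= #|A| ->
  exists2 B : {set T}, B \subset A & #|B| = i.
Proof.
move=> iA; exists [set x in take i (enum A)].
  by apply/subsetP => x; rewrite inE => /mem_take; rewrite mem_enum.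
rewrite cardsE (card_uniqP _) ?take_uniq ?enum_uniq // size_takel //.
by rewrite -cardE.
Qed.

Section BernLarge.
Import ring lra Order.TTheory GRing.Theory Num.Theory.
Local Open Scope ring_scope.

(** Supplies the hypothesis of [law_le_bern]: by the lower Chernoff bound, a mean size mp slightly
    above s suffices. *)
Lemma bern_prob_large (R : realFieldType) (expo : R -> R)
    (expoD : forall x y, expo (x + y) = expo x * expo y) (expo_ge1D : forall x, 1 + x <= expo x)
    (m s : nat) (p eta : R) :
  0 <= p <= 1 -> 0 <= eta <= 2 -> s%:R <= (1 - eta) * (m%:R * p) ->
  expo (- (m%:R * p * eta ^+ 2 / 8)) <= 1 / 2 ->
  1 / 2 <= bern_prob p (fun S : {set 'I_m} => s <= #|S|)%N.
Proof.
move=> p01 e02 hs h.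
have b0 b := bern_ge0 (p := p) b p01.
have low := count_coords_lower expoD expo_ge1D 'I_m b0 (bern_sum1 p) id e02.
have pE : \sum_(b | id b) bern p b = p.
  by rewrite big_mkcond big_bool /= addr0.
rewrite pE card_ord in low.
have : prob (bern p) (fun f : {ffun 'I_m -> bool} => xpredT f) <=
    prob (bern p) (fun f : {ffun 'I_m -> bool} => (s <= #|[set w | f w]|)%N)
  + prob (bern p) (fun f : {ffun 'I_m -> bool} =>
      (count_coords id f)%:R <= (1 - eta) * (m%:R * p)).
  apply: (prob_or b0) => f _; case: (leqP s) => //= h1.
  by apply: le_trans hs; rewrite ler_nat ltnW.
have -> : prob (bern p) (fun f : {ffun 'I_m -> bool} => xpredT f) = 1.
  by rewrite -[RHS](expect_cst 'I_m (bern_sum1 p)).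
rewrite -/(bern_prob p (fun S : {set 'I_m} => s <= #|S|)%N); lra.
Qed.

End BernLarge.

Section IntersectionGraph.
Import ring lra Order.TTheory GRing.Theory Num.Theory.
Local Open Scope ring_scope.
Variables (R : realFieldType) (expo : R -> R).
Hypothesis expoD : forall x y, expo (x + y) = expo x * expo y.
Hypothesis expo_ge1D : forall x, 1 + x <= expo x.
Variables (n m : nat) (P : nat -> R).
Hypothesis P_ge0 : forall k, (k <= m)%N -> 0 <= P k.
Hypothesis P_sum1 : \sum_(k < m.+1) P k = 1.
Variable s : nat.
Implicit Type f : config n m.

Local Notation Pr := (prob (I := 'I_n) (law (m := m) P)).
Let large (S : {set 'I_m}) := (s <= #|S|)%N.
Let l0 := law_ge0 P_ge0.
Let l1 := law_sum1 P_sum1.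
Definition tail_mass : R := \sum_(k < m.+1 | (s <= k)%N) P k.
Local Notation q := tail_mass.

Lemma law_large : \sum_(S | large S) law P S = q.
Proof. exact: (sum_law_card m P (fun k => s <= k)%N). Qed.

Lemma tail_mass_ge0 : 0 <= q.
Proof. by rewrite -law_large; apply: sumr_ge0 => S _; apply: l0. Qed.

Definition nonadjacent_large f : nat :=
  \sum_u \sum_(v | u != v) [&& large (f u), large (f v) & f v :&: f u == set0].

(** The large vertices adjacent to all other large vertices form a clique, and every large vertex
    left out is the first entry of at least one of the ordered nonadjacent pairs counted. *)
Lemma count_large_le f :
  (count_coords large f <= clique_number f + nonadjacent_large f)%N.
Proof.
pose A := [set u | large (f u) &
  [forall v, (large (f v) && (u != v)) ==> (f v :&: f u != set0)]].
have cA : is_clique f A.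
  apply/forall_inP => u; rewrite inE => /andP[_ /forallP Hu].
  apply/forall_inP => v; rewrite inE => /andP[Lv _]; apply/implyP => uv.
  by rewrite /adjacent uv setIC; have := Hu v; rewrite Lv uv.
have leA : (#|A| <= clique_number f)%N.
  exact: (leq_bigmax_cond (F := fun A : {set 'I_n} => #|A|)).
apply: leq_trans (leq_add leA (leqnn _)).
rewrite /count_coords -(cardsID A) leq_add //.
  by apply: subset_leq_card; apply: subsetIr.
rewrite -sum1_card /nonadjacent_large big_mkcond; apply: leq_sum => u _.
rewrite !inE; case Lu: (large (f u)); rewrite ?andbF //= andbT.
case: forallP => //= /forallP; rewrite negb_forall => /existsP[v].
rewrite negb_imply negbK => /andP[/andP[Lv uv] e].
by rewrite (bigD1 v) //= Lv e.
Qed.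

Lemma expect_nonadjacent_large :
  expect (law P) (fun f : config n m => (nonadjacent_large f)%:R)
    <= n%:R ^+ 2 * (q ^+ 2 * expo (- (s%:R ^+ 2 / m%:R))).
Proof.
set e := expo _.
have q0 := tail_mass_ge0.
have e0 : 0 <= e by apply/ltW/(expo_gt0 expoD expo_ge1D).
have pair u v : u != v -> expect (law P) (fun f : config n m =>
    ([&& large (f u), large (f v) & f v :&: f u == set0] : nat)%:R) <= q ^+ 2 * e.
  move=> uv; rewrite (expect_marginal2 l1 (fun S S' =>
    ([&& large S, large S' & S' :&: S == set0] : nat)%:R) uv).
  rewrite expr2 -{1}law_large -mulrA mulr_suml [leRHS]big_mkcond; apply: ler_sum => S _.
  case LS: (large S); last by rewrite big1 ?mulr0 // => S' _; rewrite mulr0.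
  by rewrite ler_wpM2l // (law_disjoint_le P_ge0 expoD expo_ge1D).
rewrite (eq_expect _ (h := fun f : config n m => \sum_u \sum_(v | u != v)
  ([&& large (f u), large (f v) & f v :&: f u == set0] : nat)%:R)); last first.
  by move=> f; rewrite natr_sum; apply: eq_bigr => u _; rewrite natr_sum.
rewrite expect_sum; apply: (@le_trans _ _ (\sum_(u : 'I_n) \sum_(v : 'I_n) q ^+ 2 * e)).
  apply: ler_sum => u _; rewrite expect_sum [leLHS]big_mkcond; apply: ler_sum => v _.
  by case: ifP => uv; [exact: pair | rewrite mulr_ge0 ?sqr_ge0].
by rewrite !sumr_const card_ord -mulrnA -[_ *+ _]mulr_natl natrM expr2.
Qed.

(** Two errors take up a share [eta] of the mean each: the fluctuation of the number of large
    vertices, by Chernoff, and the number of nonadjacent pairs, by Markov. *)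
Theorem clique_number_lower (eta : R) : 0 < eta <= 1 -> 0 < n%:R * q ->
  Pr (fun f => (clique_number f)%:R < (1 - 2 * eta) * (n%:R * q)) <=
  expo (- (n%:R * q * eta ^+ 2 / 8)) + n%:R * q * expo (- (s%:R ^+ 2 / m%:R)) / eta.
Proof.
move=> /andP[e0 e1] nq0; set nq := n%:R * q.
pose E1 f := (count_coords large f)%:R <= (1 - eta) * nq.
pose E2 f := eta * nq <= (nonadjacent_large f)%:R.
apply: (le_trans (prob_or l0 (F := E1) (G := E2) _)).
  move=> f h; rewrite /E1 /E2; case: leP => //= h1.
  have : (count_coords large f)%:R <= (clique_number f)%:R + (nonadjacent_large f)%:R :> R.
    by rewrite -natrD ler_nat count_large_le.
  lra.
apply: lerD.
  have := count_coords_lower expoD expo_ge1D 'I_n l0 l1 large (eta := eta).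
  rewrite card_ord law_large; apply; lra.
have en0 : 0 < eta * nq by exact: mulr_gt0.
apply: (le_trans (markov l0 (c := eta * nq)
  (g := fun f => (nonadjacent_large f)%:R) _ _ _)) => //.
rewrite ler_pdivrMr //; apply: (le_trans expect_nonadjacent_large).
rewrite le_eqVlt; apply/orP; left; apply/eqP; rewrite /nq; field.
exact: lt0r_neq0.
Qed.

(** The probability that a given attribute lies in a given attribute set; n times it is the mean
    attribute degree. *)
Definition mean_density : R := (\sum_(k < m.+1) P k * k%:R) / m%:R.

Definition small_degree f (w : 'I_m) : nat :=
  #|[set v | (#|f v| < s)%N && (w \in f v)]|.

(** Without the size restriction the degree of w is a sum of n independent indicators of mean
    [mean_density]. The tilt [lam] stays free because the union bound over attributes costs a factor
    m. *)
Lemma small_degree_tail (D : nat) (lam : R) : 0 <= lam ->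
  Pr (fun f => [exists w, (D < small_degree f w)%N]) <=
  m%:R * expo (n%:R * mean_density * expo lam - lam * D%:R).
Proof.
move=> lam0.
apply: (le_trans (prob_union l0 (Q := xpredT)
  (F := fun w f => lam * D%:R <= \sum_v lam * (w \in f v)%:R) _)).
  move=> f /existsP[w dw]; exists w => //.
  rewrite -mulr_sumr ler_wpM2l // -natr_sum ler_nat (leq_trans (ltnW dw)) //.
  rewrite /small_degree -sum1_card big_mkcond; apply: leq_sum => v _.
  by rewrite inE; case: (w \in f v); rewrite ?andbF //; case: ifP.
set e := expo _; have -> : m%:R * e = \sum_(w : 'I_m) e.
  by rewrite mulr_natl sumr_const card_ord.
rewrite {}/e; apply: ler_sum => w _.
pose b : R := mean_density * expo lam.
apply: (le_trans (chernoff expoD expo_ge1D l0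
  (a := fun _ S => lam * (w \in S)%:R) (b := fun=> b) _ _)).
  move=> _; rewrite (mgf_ind expoD expo_ge1D l1) lerD2l /b /mean_density -(law_mem P w).
  rewrite [X in _ <= X * _](_ : _ = \sum_(S : {set 'I_m} | w \in S) law P S).
    by rewrite ler_wpM2l ?sumr_ge0 // gerBl ler01.
  by rewrite [RHS]big_mkcond; apply: eq_bigr => S _; case: (w \in S); rewrite ?mulr1 ?mulr0.
by rewrite sumr_const card_ord /b -[_ *+ n]mulr_natl mulrA.
Qed.

Variables (i t D : nat) (p : R).
Hypothesis p01 : 0 <= p <= 1.
Hypothesis bern_large : 1 / 2 <= bern_prob p (fun S : {set 'I_m} => s <= #|S|)%N.

(** With one set S fixed, a large overlap with S is an increasing event for the other set, so
    [law_le_bern] applies. Weights 1/2 on S give the exponent p|S| - t/2 in [bern_chernoff]. *)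
Lemma overlap_tail :
  Pr (fun f => [exists u, exists v, [&& u != v, (#|f u| <= s)%N, (#|f v| <= s)%N
      & (t < #|f u :&: f v|)%N]])
    <= n%:R ^+ 2 * (2 * expo (p * s%:R - t%:R / 2)).
Proof.
have [p0 p1] := andP p01.
set e := 2 * _.
have e0 : 0 <= e by rewrite mulr_ge0 // ltW // (expo_gt0 expoD expo_ge1D).
apply: (le_trans (prob_union l0 (Q := fun uv : 'I_n * 'I_n => uv.1 != uv.2)
  (F := fun uv f => [&& (#|f uv.1| <= s)%N, (#|f uv.2| <= s)%N
      & (t < #|f uv.1 :&: f uv.2|)%N]) _)).
  by move=> f /existsP[u /existsP[v /and4P[uv fu fv h]]]; exists (u, v); rewrite //= fu fv h.
rewrite big_mkcond /=.
apply: (@le_trans _ _ (\sum_(uv : 'I_n * 'I_n) e)); last first.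
  by rewrite sumr_const card_prod card_ord expr2 -natrM mulr_natl.
apply: ler_sum => -[u v] _ /=; case: ifP => // uv.
rewrite /prob (expect_marginal2 l1 (fun S S' => ([&& (#|S| <= s)%N, (#|S'| <= s)%N
      & (t < #|S :&: S'|)%N])%:R) uv).
rewrite -[leRHS]mul1r -[X in _ <= X * _]l1 mulr_suml; apply: ler_sum => S _.
rewrite ler_wpM2l //; case: (leqP #|S| s) => [Ss|_] /=; last first.
  by rewrite big1 // => S' _; rewrite mulr0.
pose E (S' : {set 'I_m}) :=
  t%:R / 2 <= \sum_w (if w \in S then 1 / 2 else 0) * (w \in S')%:R :> R.
apply: (@le_trans _ _ (\sum_(S' : {set 'I_m}) law P S' * ((#|S'| <= s)%N && E S')%:R)).
  apply: ler_sum => S' _; rewrite ler_wpM2l // ler_nat.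
  case: (_ <= s)%N => //=; case: leqP => //= tS; rewrite lt0b /E.
  apply: (@le_trans _ _ (#|S :&: S'|%:R / 2)).
    by rewrite ler_wpM2r ?invr_ge0 ?ler0n // ler_nat ltnW.
  rewrite -sum1_card natr_sum mulr_suml big_mkcond.
  apply: ler_sum => w _; rewrite inE; case: (w \in S); case: (w \in S') => /=;
  by rewrite ?mulr1 ?mulr0 ?mul0r.
apply: le_trans (law_le_bern P_ge0 P_sum1 _ p01 bern_large) _.
  move=> S1 S2 S12; rewrite /E => h; apply: le_trans h _; apply: ler_sum => w _.
  rewrite ler_wpM2l //; first by case: ifP => // _; lra.
  by rewrite ler_nat; case w1: (w \in S1) => //; rewrite (subsetP S12 w w1).
rewrite ler_wpM2l //; apply: le_trans (bern_chernoff expoD expo_ge1D p01 _ _) _.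
  by move=> w; case: ifP => _; lra.
apply: (expo_le expoD expo_ge1D); rewrite lerD2r -big_mkcond sumr_const.
rewrite -[_ *+ _]mulr_natl.
have : p * #|S|%:R <= p * s%:R by rewrite ler_wpM2l // ler_nat.
lra.
Qed.

(** The bound of [bern_hit_all] for |B| = i, doubled by the passage to Bernoulli subsets. *)
Definition hit_all_bound : R :=
  2 * (expo (p * (i%:R ^+ 2 * t%:R) / D%:R - i%:R / (4 * D%:R))
       + expo (- ((1 - p) ^+ s * (i%:R / 2)))).

Hypothesis D_gt0 : (0 < D)%N.

Definition spread_family f (B : {set 'I_n}) : bool :=
  [&& [forall v in B, #|f v| <= s]%N,
      [forall u in B, forall v in B, (u != v) ==> (#|f u :&: f v| <= t)%N] &
      [forall w, #|[set v in B | w \in f v]| <= D]%N].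

Lemma law_hit_all f (B : {set 'I_n}) : #|B| = i -> spread_family f B ->
  \sum_(S : {set 'I_m}) law P S *
     ((#|S| <= s)%N && [forall u in B, S :&: f u != set0])%:R <= hit_all_bound.
Proof.
move=> cB /and3P[/forall_inP fs /forall_inP ft /forallP fD].
apply: le_trans (law_le_bern P_ge0 P_sum1 _ p01 bern_large) _.
  move=> S S' SS' /forall_inP H; apply/forall_inP => u /H.
  by rewrite -!card_gt0 => h; apply: leq_trans h _; rewrite subset_leq_card ?setSI.
rewrite ler_wpM2l // -cB.
apply: (bern_hit_all expoD expo_ge1D p01) => // u v uB vB uv.
by have /forall_inP/(_ v vB) := ft u uB; rewrite uv.
Qed.

(** Both the spread condition and the sets to be hit depend only on the coordinates in B, so the
    vertices of C act independently and contribute one factor each. *)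
Lemma hit_all_pair (B C : {set 'I_n}) : #|B| = i -> #|C| = i -> [disjoint B & C] ->
  Pr (fun f => spread_family f B &&
     [forall v in C, (#|f v| <= s)%N && [forall u in B, f v :&: f u != set0]])
  <= hit_all_bound ^+ i.
Proof.
move=> cB cC BC; rewrite -[X in _ ^+ X]cC.
have spl v f f' u : v \in C -> u \in B -> splice [set v] f f' u = f u.
  move=> vC uB; rewrite ffunE inE; case: eqP => // uv.
  by have := disjointFr BC uB; rewrite uv vC.
apply: (prob_all_le l0 l1 (G := fun f => spread_family f B)
  (Phi := fun f S => (#|S| <= s)%N && [forall u in B, S :&: f u != set0])).
- by rewrite mulr_ge0 // addr_ge0 // ltW // (expo_gt0 expoD expo_ge1D).
- move=> v f f' vC; rewrite /spread_family; congr [&& _, _ & _].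
  + by apply: eq_forallb_in => u uB; rewrite spl.
  + apply: eq_forallb_in => u uB; apply: eq_forallb_in => u' uB'.
    by rewrite !spl.
  + apply: eq_forallb => w; congr (_ <= _)%N; apply: eq_card => u; rewrite !inE.
    by case: (boolP (u \in B)) => //= uB; rewrite spl.
- move=> v f f' S vC; congr (_ && _); apply: eq_forallb_in => u uB.
  by rewrite spl.
- by move=> f; apply: law_hit_all.
Qed.

(* A clique with [2 * i] small vertices splits into halves [B] and [C]; unless an
   attribute degree or an overlap is atypical, [B] is a spread family, and each
   vertex of [C] independently has to hit every set of it. *)
Theorem clique_number_upper (lam : R) : 0 <= lam ->
  Pr (fun f => (count_coords large f + 2 * i <= clique_number f)%N) <=
  m%:R * expo (n%:R * mean_density * expo lam - lam * D%:R)
  + n%:R ^+ 2 * (2 * expo (p * s%:R - t%:R / 2))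
  + (n%:R ^+ 2 * hit_all_bound) ^+ i.
Proof.
move=> lam0.
pose E1 f := [exists w, (D < small_degree f w)%N].
pose E2 f := [exists u, exists v, [&& u != v, (#|f u| <= s)%N, (#|f v| <= s)%N
      & (t < #|f u :&: f v|)%N]].
pose F (BC : {set 'I_n} * {set 'I_n}) f := spread_family f BC.1 &&
     [forall v in BC.2, (#|f v| <= s)%N && [forall u in BC.1, f v :&: f u != set0]].
pose Q (BC : {set 'I_n} * {set 'I_n}) :=
  [&& #|BC.1| == i, #|BC.2| == i & [disjoint BC.1 & BC.2]].
pose E3 f := [exists BC, Q BC && F BC f].
have cover f : (count_coords large f + 2 * i <= clique_number f)%N ->
    E1 f || E2 f || E3 f.
  move=> h; case: (boolP (E1 f)) => //= nE1; case: (boolP (E2 f)) => //= nE2.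
  have c0 : is_clique f set0 by apply/forall_inP => v; rewrite inE.
  have [A cA eA] : {A | A \in is_clique f & clique_number f = #|A|}.
    by apply: eq_bigmax_cond; apply/card_gt0P; exists set0.
  pose As := [set v in A | (#|f v| < s)%N].
  have cAs : (2 * i <= #|As|)%N.
    have : (#|A :\: As| <= count_coords large f)%N.
      rewrite /count_coords; apply: subset_leq_card; apply/subsetP => v.
      by rewrite !inE /large => /andP[+ vA]; rewrite vA /= -leqNgt.
    have := cardsID As A; have -> : A :&: As = As.
      by apply/setIidPr/subsetP => v; rewrite inE => /andP[].
    by move: h; rewrite eA; lia.
  have [B BA cB] : exists2 B : {set 'I_n}, B \subset As & #|B| = i.
    by apply: exists_subset_card; apply: leq_trans cAs; rewrite leq_pmull.
  have [C CA cC] : exists2 C : {set 'I_n}, C \subset As :\: B & #|C| = i.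
    apply: exists_subset_card; have := cardsID B As.
    by rewrite (setIidPr BA) cB; lia.
  have BC : [disjoint B & C].
    by rewrite disjoint_sym; move: CA; rewrite subsetD => /andP[].
  have {}CA : C \subset As by move: CA; rewrite subsetD => /andP[].
  have small v : v \in As -> (#|f v| <= s)%N by rewrite inE => /andP[_ /ltnW].
  apply/existsP; exists (B, C); rewrite /Q /F /= cB cC BC !eqxx /=.
  apply/andP; split; last first.
    apply/forall_inP => v vC; rewrite small ?(subsetP CA) //=.
    apply/forall_inP => u uB.
    have uA := subsetP BA u uB; have vA := subsetP CA v vC.
    have uv : v != u by apply: contraTneq vC => ->; rewrite (disjointFr BC).
    move: uA vA; rewrite !inE => /andP[uA _] /andP[vA _].
    have /forall_inP/(_ v vA)/forall_inP/(_ u uA) := cA.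
    by rewrite uv /= => /andP[].
  apply/and3P; split.
  - by apply/forall_inP => v vB; apply: small; apply: (subsetP BA).
  - apply/forall_inP => u uB; apply/forall_inP => v vB; apply/implyP => uv.
    move: nE2; rewrite /E2 negb_exists => /forallP/(_ u).
    rewrite negb_exists => /forallP/(_ v).
    by rewrite uv !small ?(subsetP BA) //= -leqNgt.
  - apply/forallP => w; move: nE1; rewrite /E1 negb_exists => /forallP/(_ w).
    rewrite -leqNgt; apply: leq_trans; apply: subset_leq_card; apply/subsetP => v.
    rewrite !inE => /andP[/(subsetP BA)]; rewrite inE => /andP[_ ->].
    by [].
apply: (le_trans (prob_or l0 (F := fun f => E1 f || E2 f) (G := E3) cover)).
apply: lerD.
  apply: (le_trans (prob_or l0 (F := E1) (G := E2) _)) => //.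
  by apply: lerD; [exact: small_degree_tail | exact: overlap_tail].
apply: (le_trans (prob_union l0 (Q := Q) (F := F) _)).
  by move=> f /existsP[BC /andP[QBC FBC]]; exists BC.
have r0 : 0 <= hit_all_bound.
  by rewrite mulr_ge0 // addr_ge0 // ltW // (expo_gt0 expoD expo_ge1D).
apply: (@le_trans _ _ (\sum_(BC : {set 'I_n} * {set 'I_n} |
    (#|BC.1| == i) && (#|BC.2| == i)) hit_all_bound ^+ i)).
  rewrite big_mkcond [leRHS]big_mkcond; apply: ler_sum => -[B C] _ /=.
  rewrite /Q /=; case: eqP => cB /=; last by [].
  case: eqP => cC //=; case: ifP => BC; last exact: exprn_ge0.
  exact: hit_all_pair.
move: hit_all_bound r0 => r r0.
(* There are C(n,i)^2 <= n^(2i) choices of (B, C), which the i-th power absorbs as a factor n^2 per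
   vertex of C. *)
rewrite exprMn exprAC sumr_const -[leLHS]mulr_natl ler_wpM2r ?exprn_ge0 //.
rewrite [X in X%:R](_ : _ = 'C(n, i) * 'C(n, i))%N; last first.
  rewrite -[n in 'C(n, i)]card_ord -card_draws -cardsX; apply: eq_card => -[B C].
  by rewrite !inE.
have h : ('C(n, i) <= n ^ i)%N.
  apply: leq_trans (_ : n ^_ i <= _)%N; first by rewrite -bin_ffact leq_pmulr ?fact_gt0.
  elim: (i) => [|j IH]; first by rewrite ffactn0 expn0.
  by rewrite ffactnSr expnSr leq_mul ?leq_subr.
by rewrite expr2 -natrX -natrM ler_nat leq_mul.
Qed.

End IntersectionGraph.

(** * Transfer to the real numbers of the standard library *)

Section Bridge.
Delimit Scope R_scope with coqR.
Import Order.TTheory GRing.Theory Num.Theory.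
Local Open Scope ring_scope.

Local Notation R := Rdefinitions.R.

Lemma rig_probE n m P (E : pred (config n m)) :
  rig_prob P E = prob (R := R) (law P) E.
Proof.
rewrite /rig_prob /prob /expect [RHS](bigID E) /= [X in _ = _ + X]big1.
  rewrite addr0; apply: eq_bigr => f ->; rewrite mulr1.
  by apply: eq_bigr => v _; rewrite /law RdivE INRE.
by move=> f /negPf ->; rewrite mulr0.
Qed.

Lemma exp_ge1Dx (x : R) : 1 + x <= exp x.
Proof.
apply/RleP; have [->|x0] := eqVneq x 0; last by left; apply: exp_ineq1 => /eqP; apply/negP.
by right; rewrite addr0 exp_0.
Qed.

Lemma exp_addE (x y : R) : exp (x + y) = exp x * exp y.
Proof. exact: exp_plus. Qed.

Lemma IZR_natE k : IZR (Z.of_nat k) = k%:R :> R.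
Proof. by rewrite -INR_IZR_INZ INRE. Qed.

Lemma prob_law_split m (P : nat -> R) : is_prob_law m P ->
  (forall k, (k <= m)%N -> 0 <= P k) /\ \sum_(k < m.+1) P k = 1.
Proof.
case=> P0 P1; split; first by move=> k km; apply/RleP/P0.
by rewrite -(big_mkord xpredT P) -[RHS]P1.
Qed.

Lemma rig_lower n m s (P : nat -> R) (eta : R) (q := tail_mass (R := R) m P s) :
  is_prob_law m P -> (0 < eta <= 1)%coqR -> (0 < INR n * q)%coqR ->
  (rig_prob P (fun f : config n m =>
     Rltb (INR (clique_number f)) ((1 - 2 * eta) * (INR n * q)))
   <= exp (- (INR n * q * eta ^ 2 / 8))
      + INR n * q * exp (- (INR s ^ 2 / INR m)) / eta)%coqR.
Proof.
move=> /prob_law_split[P0 P1] [/RltP e0 /RleP e1] /RltP nq0.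
rewrite INRE RmultE in nq0.
have e01 : 0 < eta <= 1 by rewrite e0 e1.
have h := clique_number_lower exp_addE exp_ge1Dx P0 P1 e01 nq0.
rewrite rig_probE; apply/RleP.
rewrite ?(RplusE, RmultE, RminusE, RoppE, RdivE, RpowE, INRE).
rewrite -[IZR 8]/(IZR (Z.of_nat 8)) IZR_natE.
apply: le_trans h; apply: le_prob; first exact: law_ge0.
move=> f; rewrite /Rltb; case: Rlt_dec => // /RltP + _.
rewrite ?(RplusE, RmultE, RminusE, RoppE, RdivE, RpowE, INRE).
by rewrite -[IZR 2]/(IZR (Z.of_nat 2)) IZR_natE.
Qed.

(** There are two slacks: [eta] in the upper Chernoff bound for the number of large vertices, and
    [eta'] between s and the mean size mp of the Bernoulli subset. *)
Lemma rig_upper n m s i t D (P : nat -> R) (eta eta' p lam : R)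
    (q := tail_mass (R := R) m P s) :
  is_prob_law m P -> (0 <= eta <= 2)%coqR ->
  (0 <= p <= 1)%coqR -> (0 <= eta' <= 2)%coqR ->
  (INR s <= (1 - eta') * (INR m * p))%coqR ->
  (exp (- (INR m * p * eta' ^ 2 / 8)) <= 1 / 2)%coqR ->
  (0 < D)%N -> (0 <= lam)%coqR ->
  (rig_prob P (fun f : config n m =>
     Rltb ((1 + eta) * (INR n * q) + 2 * INR i) (INR (clique_number f)))
   <= exp (- (INR n * q * eta ^ 2 / 8)) +
      (INR m * exp (INR n * mean_density (R := R) m P * exp lam - lam * INR D)
       + INR n ^ 2 * (2 * exp (p * INR s - INR t / 2))
       + (INR n ^ 2 * (2 *
           (exp (p * (INR i ^ 2 * INR t) / INR D - INR i / (4 * INR D))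
            + exp (- ((1 - p) ^ s * (INR i / 2)))))) ^ i))%coqR.
Proof.
move=> /prob_law_split[P0 P1] [/RleP e0 /RleP e2] [/RleP p0 /RleP p1] [/RleP e0' /RleP e2'].
move=> /RleP hs /RleP hb D0 /RleP lam0.
move: hs hb e2 e2'; rewrite ?(RplusE, RmultE, RminusE, RoppE, RdivE, RpowE, INRE).
rewrite -[IZR 8]/(IZR (Z.of_nat 8)) -[IZR 2]/(IZR (Z.of_nat 2)).
rewrite -[IZR 4]/(IZR (Z.of_nat 4)) !IZR_natE.
move=> hs hb e2 e2'.
have p01 : 0 <= p <= 1 by rewrite p0 p1.
have e02 : 0 <= eta <= 2 by rewrite e0 e2.
have e02' : 0 <= eta' <= 2 by rewrite e0' e2'.
have bl := bern_prob_large exp_addE exp_ge1Dx p01 e02' hs hb.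
have h := clique_number_upper exp_addE exp_ge1Dx n P0 P1 i t p01 bl D0 lam0.
have l0 := law_ge0 P0.
have c := count_coords_upper exp_addE exp_ge1Dx 'I_n l0 (law_sum1 P1)
  (fun S => s <= #|S|)%N e02.
rewrite card_ord law_large in c.
rewrite rig_probE; apply/RleP.
rewrite ?(RplusE, RmultE, RminusE, RoppE, RdivE, RpowE, INRE).
apply: le_trans (lerD c h); apply: (prob_or l0) => f.
rewrite /Rltb; case: Rlt_dec => // /RltP + _.
rewrite ?(RplusE, RmultE, RminusE, RoppE, RdivE, RpowE, INRE) R1E => h2.
case: leP => //= h1.
have : (count_coords (fun S : {set 'I_m} => s <= #|S|)%N f + 2 * i)%:R
    <= (clique_number f)%:R :> R.
  by rewrite natrD natrM; apply/ltW/(le_lt_trans _ h2); rewrite lerD2r; apply: ltW h1.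
by rewrite ler_nat.
Qed.

Lemma rig_prob_ge0 n m (P : nat -> R) (E : pred (config n m)) :
  is_prob_law m P -> (0 <= rig_prob P E)%coqR.
Proof.
move=> /prob_law_split[P0 P1]; rewrite rig_probE; apply/RleP.
by apply: prob_ge0; apply: law_ge0.
Qed.

Lemma rig_prob_or n m (P : nat -> R) (E F G : pred (config n m)) :
  is_prob_law m P -> (forall f, E f -> F f || G f) ->
  (rig_prob P E <= rig_prob P F + rig_prob P G)%coqR.
Proof.
move=> /prob_law_split[P0 P1] h; rewrite !rig_probE; apply/RleP.
by apply: prob_or => //; apply: law_ge0.
Qed.

Lemma rig_prob_le n m (P : nat -> R) (E F : pred (config n m)) :
  is_prob_law m P -> (forall f, E f -> F f) -> (rig_prob P E <= rig_prob P F)%coqR.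
Proof.
move=> /prob_law_split[P0 P1] h; rewrite !rig_probE; apply/RleP.
by apply: le_prob => //; apply: law_ge0.
Qed.

Lemma tailY_le n m (P : nat -> R) (x y : R) : is_prob_law m P -> (x <= y)%coqR ->
  (tailY n m P y <= tailY n m P x)%coqR.
Proof.
move=> [P0 _] xy; rewrite /tailY !big_mkord big_mkcond [X in Rle _ X]big_mkcond /=.
apply/RleP; apply: ler_sum => k _.
have Pk : 0 <= P k by apply/RleP/P0; rewrite -ltnS.
rewrite /Rleb; case: Rle_dec => hy; case: Rle_dec => hx //=.
by case: hx; apply: Rle_trans hy.
Qed.

Lemma tailY_tail_mass n m s (P : nat -> R) (x : R) :
  (forall k, (x <= scaleY n m * INR k)%coqR <-> (s <= k)%N) ->
  tailY n m P x = tail_mass (R := R) m P s.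
Proof.
move=> h; rewrite /tailY /tail_mass -(big_mkord (fun k => s <= k)%N P).
apply: eq_bigl => k; rewrite /Rleb; case: Rle_dec => hk.
  by apply/esym/h.
by apply/esym/negP => /h.
Qed.

(** Both sides are n E X / m. Condition (A) thus bounds the mean attribute degree by
    O((n/m)^(1/2)). *)
Lemma mean_density_EY n m (P : nat -> R) : (0 < m)%N ->
  (INR n * mean_density (R := R) m P = scaleY n m * EY n m P)%coqR.
Proof.
move=> m0; rewrite /EY -Rmult_assoc /scaleY sqrt_sqrt; last first.
  apply: Rmult_le_pos; first exact: pos_INR.
  by left; apply: Rinv_0_lt_compat; apply: lt_0_INR; apply/ssrnat.ltP.
rewrite /mean_density -(big_mkord xpredT (fun k => P k * k%:R)).
have -> : \sum_(0 <= k < m.+1) P k * k%:R =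
    \big[Rplus/IZR Z0]_(0 <= k < m.+1) Rmult (INR k) (P k).
  by apply: eq_bigr => k _; rewrite RmultE INRE mulrC.
move: (\big[Rplus/IZR Z0]_(_ <= k < _) _) => S.
by rewrite -INRE /Rdiv !RmultE RinvE mulrA mulrAC.
Qed.

End Bridge.

(** * Asymptotics *)

Open Scope R_scope.

Definition eventually (Q : nat -> Prop) := exists N, forall n, (N <= n)%N -> Q n.

Lemma ev_all (Q : nat -> Prop) : (forall n, Q n) -> eventually Q.
Proof. by move=> h; exists 0%N. Qed.

Lemma ev_mp (A B : nat -> Prop) :
  eventually A -> eventually (fun n => A n -> B n) -> eventually B.
Proof.
move=> [N hN] [M hM]; exists (maxn N M) => n; rewrite geq_max => /andP[h1 h2].
by apply: hM => //; apply: hN.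
Qed.

Lemma ev_Un_cv (u : nat -> R) (l : R) :
  Un_cv u l <-> forall eps, 0 < eps -> eventually (fun n => Rabs (u n - l) < eps).
Proof.
split=> h eps e0; have [N hN] := h eps e0; exists N => n Nn; apply: hN.
  by apply/leP.
by move: Nn => /leP.
Qed.

Lemma ln_le_ln x y : 0 < x -> x <= y -> ln x <= ln y.
Proof. by move=> x0 [xy|->]; [left; apply: ln_increasing | right]. Qed.

Lemma ln_large C : eventually (fun n => C <= ln (INR n)).
Proof.
have [N hN] := INR_unbounded (exp C); exists N => n /leP Nn.
rewrite -(ln_exp C); apply: ln_le_ln; first exact: exp_pos.
by have := le_INR _ _ Nn; lra.
Qed.

Lemma Rpower_large C g : 0 < g -> eventually (fun n => C <= Rpower (INR n) g).
Proof.
move=> g0; apply: ev_mp (ln_large (C / g)) _; apply: ev_all => n h.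
have := exp_ineq1_le (g * ln (INR n)); rewrite /Rpower.
have : C <= g * ln (INR n).
  by apply: (Rmult_le_reg_r (/ g)); [exact: Rinv_0_lt_compat | field_simplify; lra].
lra.
Qed.

Lemma ln_le_Rpower C g : 0 < g -> eventually (fun n => C * ln (INR n) <= Rpower (INR n) g).
Proof.
(* With l = ln n, n^g = exp(gl/2)^2 >= (gl/2)^2, which exceeds Cl once l >= 4|C|/g^2. *)
move=> g0; apply: ev_mp (ln_large (4 * Rabs C / (g * g))) _.
apply: ev_mp (ln_large 0) _; apply: ev_all => n l0 h.
set l := ln (INR n) in l0 h *.
have e : Rpower (INR n) g = exp (g * l / 2) * exp (g * l / 2).
  by rewrite -exp_plus /Rpower; congr exp; rewrite /l; lra.
rewrite e; have h1 := exp_ineq1_le (g * l / 2).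
have gl : 0 <= g * l / 2 by have := Rmult_le_pos _ _ (Rlt_le _ _ g0) l0; lra.
have h2 : (g * l / 2) * (g * l / 2) <= exp (g * l / 2) * exp (g * l / 2).
  by apply: Rmult_le_compat; lra.
apply: Rle_trans h2.
have h3 : Rabs C <= l * (g * g) / 4.
  have := Rmult_le_compat_r (g * g) _ _ (Rlt_le _ _ (Rmult_lt_0_compat _ _ g0 g0)) h.
  rewrite /Rdiv Rmult_assoc Rinv_l; first lra.
  by have := Rmult_lt_0_compat _ _ g0 g0; lra.
have h4 := Rle_abs C.
have := Rmult_le_compat_r l _ _ l0 (Rle_trans _ _ _ h4 h3); lra.
Qed.

Lemma Rpower_gt0 x y : 0 < Rpower x y.
Proof. exact: exp_pos. Qed.

(* [L] need not be measurable, so Potter-type bounds are only available along a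
   dyadic sequence; monotonicity of the tail of Y fills the gaps later. *)
Lemma slowly_varying_dyadic (L : R -> R) e : slowly_varying L -> 0 < e ->
  exists x0 c C, [/\ 1 <= x0, 0 < c, 0 < C & forall j,
    c * Rpower (2 ^ j * x0) (- e) <= L (2 ^ j * x0) <= C * Rpower (2 ^ j * x0) e].
Proof.
move=> [L0 Lsv] e0.
pose b := Rpower 2 e.
have b1 : 1 < b by rewrite /b -(Rpower_O 2); [apply: Rpower_lt; lra | lra].
have bV : Rpower 2 (- e) = / b by rewrite Rpower_Ropp.
have b0 : 0 < / b by apply: Rinv_0_lt_compat; lra.
have bV1 : / b < 1 by rewrite -Rinv_1; apply: Rinv_lt_contravar; lra.
(* With this tolerance a doubling of the argument changes L by a factor between 2^(-e) and 2^e. *)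
pose d := Rmin (1 - / b) (b - 1).
have d0 : 0 < d by apply: Rmin_glb_lt; lra.
have [M hM] := Lsv 2 ltac:(lra) d d0.
pose x0 := Rmax 1 (M + 1).
have x1 : 1 <= x0 by apply: Rmax_l.
have xM : M < x0 by have := Rmax_r 1 (M + 1); rewrite -/x0; lra.
have pj j : 1 <= 2 ^ j by apply: pow_R1_Rle; lra.
have xj j : x0 <= 2 ^ j * x0 by have := Rmult_le_compat_r x0 _ _ ltac:(lra) (pj j); lra.
have step j : / b * L (2 ^ j * x0) <= L (2 ^ j.+1 * x0) <= b * L (2 ^ j * x0).
  have := hM (2 ^ j * x0) ltac:(have := xj j; lra).
  have -> : 2 * (2 ^ j * x0) = 2 ^ j.+1 * x0 by rewrite /=; lra.
  set u := L (2 ^ j * x0); set v := L _; have u0 : 0 < u by apply: L0; have := xj j; lra.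
  have d1 : d <= 1 - / b by apply: Rmin_l.
  have d2 : d <= b - 1 by apply: Rmin_r.
  move/Rabs_def2 => [h1 h2].
  have hv : v = v / u * u by field; lra.
  rewrite hv; split; apply: Rmult_le_compat_r; lra.
have rp j z : Rpower (2 ^ j.+1 * x0) z = Rpower 2 z * Rpower (2 ^ j * x0) z.
  have h : 0 < 2 ^ j * x0 by have := xj j; lra.
  rewrite (Rpower_mult_distr _ _ _ Rlt_0_2 h); congr (Rpower _ z).
  by rewrite /=; lra.
exists x0, (L x0 * Rpower x0 e), (L x0 * Rpower x0 (- e)).
have Lx0 : 0 < L x0 by apply: L0; lra.
split=> //; try (by apply: Rmult_lt_0_compat => //; apply: Rpower_gt0).
elim=> [|j [IH1 IH2]].
  rewrite /= Rmult_1_l !Rmult_assoc -!Rpower_plus.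
  rewrite Rplus_opp_l Rplus_opp_r Rpower_O; lra.
have [s1 s2] := step j; rewrite !rp bV -/b; split.
  apply: Rle_trans s1; rewrite -Rmult_assoc (Rmult_comm _ (/ b)) Rmult_assoc.
  by apply: Rmult_le_compat_l; lra.
apply: Rle_trans s2 _; rewrite -(Rmult_assoc _ b) (Rmult_comm _ b) Rmult_assoc.
by apply: Rmult_le_compat_l; lra.
Qed.

Lemma dyadic_between x0 X : 1 <= x0 <= X ->
  exists j, 2 ^ j * x0 <= X < 2 ^ j.+1 * x0.
Proof.
move=> [x1 xX].
have [N hN] : exists N, X < 2 ^ N * x0.
  have [N hN] := Pow_x_infinity 2 ltac:(rewrite Rabs_pos_eq; lra) (X + 1).
  exists N; have := hN N (PeanoNat.Nat.le_refl N).
  have p : 1 <= 2 ^ N by apply: pow_R1_Rle; lra.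
  rewrite Rabs_pos_eq; last lra.
  by have := Rmult_le_compat_l (2 ^ N) 1 x0 ltac:(lra) x1; lra.
elim: N hN => [|N IH] hN; first by exists 0%N; move: hN; rewrite /= ; lra.
by have [h|h] := Rlt_le_dec X (2 ^ N * x0); [exact: IH | exists N].
Qed.

Lemma Rpower_le_base_neg x y z : 0 < x <= y -> z <= 0 -> Rpower y z <= Rpower x z.
Proof.
move=> [x0 xy] z0; have := ln_le_ln x0 xy; rewrite /Rpower => h.
have : z * ln y <= z * ln x by apply: Rmult_le_compat_neg_l.
by case=> [h1|->]; [left; apply: exp_increasing | right].
Qed.

Lemma Rpower_le_exp n x y : 0 <= ln (INR n) -> x <= y ->
  Rpower (INR n) x <= Rpower (INR n) y.
Proof.
move=> l0 xy; have : x * ln (INR n) <= y * ln (INR n) by apply: Rmult_le_compat_r.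
by rewrite /Rpower; case=> [h1|->]; [left; apply: exp_increasing | right].
Qed.

(** * Consequences of (PL) near (n ln n)^(1/2) *)

Definition root_nln (n : nat) : R := sqrt (INR n * ln (INR n)).

Definition expected_large (m : nat -> nat) (P : nat -> nat -> R) (tau : R) (n : nat) : R :=
  INR n * tailY n (m n) (P n) (sqrt tau * root_nln n).

Section Asymptotics.
Variables (alpha : R) (m : nat -> nat) (P : nat -> nat -> R) (L : R -> R) (eps0 : R).
Hypothesis Halpha : 1 < alpha < 2.
Hypothesis HP : forall n, is_prob_law (m n) (P n).
Hypothesis HL : slowly_varying L.
Hypothesis Heps0 : 0 < eps0 < /2.
Hypothesis HPL : condPL m P alpha L eps0.

Local Notation tail n x := (tailY n (m n) (P n) x).
Local Notation a := (1 - alpha / 2).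
Local Notation in_window n x :=
  (Rpower (INR n) (/2 - eps0) <= x <= Rpower (INR n) (/2 + eps0)).

(** [ln] is 0 on nonpositive arguments, so a positive logarithm already excludes n = 0. *)
Lemma INR_eq_exp n : 0 < ln (INR n) -> INR n = exp (ln (INR n)).
Proof.
move=> l0; rewrite exp_ln //; case: n l0 => [|n] l0.
  by move: l0; rewrite /= /ln; case: Rlt_dec => h l0; lra.
by apply: lt_0_INR; apply: PeanoNat.Nat.lt_0_succ.
Qed.

Lemma ln_INR_ge0 n : 0 <= ln (INR n).
Proof.
case: n => [|n]; first by rewrite /= /ln; case: Rlt_dec => h; [case: (Rlt_irrefl _ h) | right].
rewrite -ln_1; apply: ln_le_ln; first lra.
by rewrite S_INR; have := pos_INR n; lra.
Qed.

(* (PL) quantifies over sequences; picking a worst point of each window turns it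
   into a statement uniform over the window. *)
Lemma condPL_uniform d : 0 < d -> eventually (fun n => forall x, in_window n x ->
  Rabs (tail n x / (L x * Rpower x (- alpha)) - 1) < d).
Proof.
move=> d0.
pose bad n x := in_window n x /\ ~ Rabs (tail n x / (L x * Rpower x (- alpha)) - 1) < d.
(* If the window has no bad point, the default n^(1/2) keeps the sequence inside it. *)
pose x n := match excluded_middle_informative (exists x, bad n x) with
  | left h => proj1_sig (constructive_indefinite_description _ h)
  | right _ => Rpower (INR n) (/2) end.
have xw n : in_window n (x n).
  rewrite /x; case: excluded_middle_informative => h.
    by case: constructive_indefinite_description => y [].
  by split; apply: Rpower_le_exp; try exact: ln_INR_ge0; lra.
have /ev_Un_cv/(_ d d0) hcv := HPL xw.
apply: (ev_mp hcv); apply: ev_all => n hx y yw; apply: NNPP => hy.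
have hb : exists x, bad n x by exists y.
move: hx; rewrite /x; case: excluded_middle_informative => // h.
by case: constructive_indefinite_description => z [_ ] /=.
Qed.

Lemma root_nln_eq n : 1 <= ln (INR n) -> root_nln n = Rpower (INR n) (/2) * sqrt (ln (INR n)).
Proof.
move=> l1; rewrite /root_nln sqrt_mult ?Rpower_sqrt //; try exact: pos_INR; try lra.
by rewrite INR_eq_exp; [exact: exp_pos | lra].
Qed.

Lemma sqrt_ge1 x : 1 <= x -> 1 <= sqrt x <= x.
Proof.
move=> x1; have h : 1 <= sqrt x by rewrite -[1]sqrt_1; apply: sqrt_le_1_alt.
split=> //; have := sqrt_sqrt x ltac:(lra) => e; rewrite -[X in _ <= X]e.
by have := Rmult_le_compat_r (sqrt x) 1 (sqrt x) ltac:(lra) h; lra.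
Qed.

(** n^e absorbs both (ln n)^(1/2) and the constants. With e = [eps0] this gives access to (PL); with
    small e it turns powers of y into powers of n. *)
Lemma root_nln_window e c C : 0 < e -> 0 < c -> eventually (fun n => forall y,
  c * root_nln n <= y <= C * root_nln n -> Rpower (INR n) (/2 - e) <= y <= Rpower (INR n) (/2 + e)).
Proof.
move=> e0 c0.
apply: ev_mp (ln_large 1) _; apply: ev_mp (Rpower_large (/ c) e0) _.
apply: ev_mp (ln_le_Rpower (Rmax C 0) e0) _; apply: ev_all => n h1 h2 l1 y.
rewrite root_nln_eq //; have [s1 s2] := sqrt_ge1 l1.
have p0 := Rpower_gt0 (INR n) (/2); move=> [hy1 hy2].
rewrite (_ : /2 - e = /2 + - e); last lra.
rewrite !Rpower_plus Rpower_Ropp; set p := Rpower (INR n) (/2) in p0 hy1 hy2 *.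
set w := Rpower (INR n) e in h1 h2 *; set s := sqrt _ in s1 s2 hy1 hy2.
have ic : 0 < / c by apply: Rinv_0_lt_compat.
split.
  apply: Rle_trans hy1; rewrite (Rmult_comm c) Rmult_assoc.
  apply: Rmult_le_compat_l; first lra.
  have : / w <= c by rewrite -(Rinv_inv c); apply: Rinv_le_contravar; lra.
  by have := Rmult_le_compat_r c 1 s ltac:(lra) s1; lra.
apply: Rle_trans hy2 _; rewrite (Rmult_comm C) Rmult_assoc.
apply: Rmult_le_compat_l; first lra.
apply: Rle_trans h1; rewrite Rmult_comm; apply: Rle_trans (_ : Rmax C 0 * s <= _).
  by apply: Rmult_le_compat_r; [lra | apply: Rmax_l].
by apply: Rmult_le_compat_l; [apply: Rmax_r | lra].
Qed.

Lemma root_nln_gt0 n : 1 <= ln (INR n) -> 0 < root_nln n.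
Proof.
by move=> l1; rewrite root_nln_eq //; apply: Rmult_lt_0_compat;
  [exact: Rpower_gt0 | have := sqrt_ge1 l1; lra].
Qed.

(** K(n) is what (PL) predicts for n P(Y >= x) at x = (n ln n)^(1/2). *)
Lemma Kn_eq n : 1 <= ln (INR n) ->
  Kn L alpha n = INR n * (L (root_nln n) * Rpower (root_nln n) (- alpha)).
Proof.
move=> l1; rewrite /Kn -/(root_nln n).
have -> : Rpower (root_nln n) (- alpha) =
    Rpower (INR n) (- (alpha / 2)) * Rpower (ln (INR n)) (- (alpha / 2)).
  rewrite Rpower_mult_distr; try lra; last by rewrite INR_eq_exp; [exact: exp_pos | lra].
  rewrite /root_nln -Rpower_sqrt; last first.
    by apply: Rmult_lt_0_compat; [rewrite INR_eq_exp; [exact: exp_pos | lra] | lra].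
  by rewrite Rpower_mult; congr (Rpower _ _); lra.
have -> : Rpower (INR n) (1 - alpha / 2) = INR n * Rpower (INR n) (- (alpha / 2)).
  rewrite /Rminus Rpower_plus Rpower_1 // INR_eq_exp; [exact: exp_pos | lra].
ring.
Qed.

(** L is controlled only at dyadic points y' <= (n ln n)^(1/2) < y = 2y'. By (PL) the tail of Y lies
    between 1/2 and 3/2 times L(z) z^(-alpha) at all three points; as the tail is monotone, the
    bounds at y and y' carry over at the cost of a factor 3. *)
Lemma Kn_bounds e : 0 < e -> eventually (fun n =>
  Rpower (INR n) (a - e) <= Kn L alpha n <= Rpower (INR n) (a + e)).
Proof.
(* The exponents are off by at most 7h/2 <= e/2; the other half of e absorbs the factors c/3 and
   3C. *)
move=> e0; pose h := Rmin (e / 8) (1 / 8).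
have h0 : 0 < h by apply: Rmin_glb_lt; lra.
have h1 : h <= e / 8 by apply: Rmin_l.
have h2 : h <= 1 / 8 by apply: Rmin_r.
have [x0 [c [C [x1 c0 C0 hj]]]] := slowly_varying_dyadic HL h0.
apply: ev_mp (ln_large 1) _.
apply: ev_mp (@condPL_uniform (1/2) ltac:(lra)) _.
apply: ev_mp (@root_nln_window eps0 (1/2) 2 ltac:(lra) ltac:(lra)) _.
apply: ev_mp (@root_nln_window h (1/2) 2 ltac:(lra) ltac:(lra)) _.
apply: ev_mp (@Rpower_large x0 (/2 - h) ltac:(lra)) _.
apply: ev_mp (@Rpower_large (3 / c) (e / 2) ltac:(lra)) _.
apply: ev_mp (@Rpower_large (3 * C) (e / 2) ltac:(lra)) _.
apply: ev_all => n n1 n2 n3 wh we PL l1.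
have X0 := root_nln_gt0 l1; have l0 := ln_INR_ge0 n.
have Xx : x0 <= root_nln n by apply: Rle_trans n3 _; apply: (proj1 (wh _ _)); lra.
have [j [y1 y2]] := dyadic_between (conj x1 Xx).
set y' := 2 ^ j * x0 in y1; set y := 2 ^ j.+1 * x0 in y2.
have yy : y = 2 * y' by rewrite /y /y' /=; lra.
have tails z : 1/2 * root_nln n <= z <= 2 * root_nln n ->
    1/2 * (L z * Rpower z (- alpha)) < tail n z < 3/2 * (L z * Rpower z (- alpha)).
  move=> hz; have := PL z (we z hz).
  have : 0 < L z * Rpower z (- alpha).
    by apply: Rmult_lt_0_compat; [apply: (proj1 HL); lra | exact: Rpower_gt0].
  set u := L z * _ => u0 /Rabs_def2[g1 g2].
  have ht : tail n z = tail n z / u * u by field; lra.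
  split; rewrite [X in _ < X]ht || rewrite [X in X < _]ht; apply: Rmult_lt_compat_r; lra.
have [tX1 tX2] := tails (root_nln n) ltac:(lra).
have [ty1 _] := tails y ltac:(lra).
have [_ ty'] := tails y' ltac:(lra).
have mono1 : tail n y <= tail n (root_nln n) by apply: tailY_le; [exact: HP | lra].
have mono2 : tail n (root_nln n) <= tail n y' by apply: tailY_le; [exact: HP | lra].
have [Ly _] := hj j.+1; have [_ Ly'] := hj j; rewrite -/y -/y' in Ly Ly'.
rewrite Kn_eq //; set T := L (root_nln n) * _ in tX1 tX2 *.
have npos : 0 < INR n by rewrite INR_eq_exp; [exact: exp_pos | lra].
have powz z : Rpower (INR n) (1 + z) = INR n * Rpower (INR n) z.
  by rewrite Rpower_plus Rpower_1.
split.
  have b1 : c * Rpower (INR n) (- (/2 + h) * (h + alpha)) <= L y * Rpower y (- alpha).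
    apply: Rle_trans (_ : c * (Rpower y (- h) * Rpower y (- alpha)) <= _); last first.
      by rewrite -Rmult_assoc; apply: Rmult_le_compat_r; [left; exact: Rpower_gt0 | lra].
    apply: Rmult_le_compat_l; first lra.
    rewrite -Rpower_plus.
    have yn : y <= Rpower (INR n) (/2 + h) by apply: (proj2 (wh _ _)); lra.
    have y0 : 0 < y by lra.
    have := @Rpower_le_base_neg y _ (- h + - alpha) (conj y0 yn) ltac:(lra).
    rewrite Rpower_mult (_ : (/2 + h) * (- h + - alpha) = - (/2 + h) * (h + alpha)) //; lra.
  have b2 : c / 3 * Rpower (INR n) (- (/2 + h) * (h + alpha)) <= T by lra.
  have ex : a - e / 2 <= 1 + - (/2 + h) * (h + alpha).
    have : h * (h + alpha) <= h * 3 by apply: Rmult_le_compat_l; lra.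
    by lra.
  have b3 := Rpower_le_exp l0 ex; rewrite powz in b3.
  have b4 : INR n * (c / 3 * Rpower (INR n) (- (/2 + h) * (h + alpha))) <= INR n * T.
    by apply: Rmult_le_compat_l; lra.
  apply: Rle_trans b4.
  have b5 : 1 <= c / 3 * Rpower (INR n) (e / 2).
    have := Rmult_le_compat_l (c / 3) _ _ ltac:(lra) n2.
    by rewrite (_ : c / 3 * (3 / c) = 1); [lra | field; lra].
  rewrite (_ : a - e = (a - e / 2) + - (e / 2)); last lra.
  rewrite Rpower_plus Rpower_Ropp.
  have pe := Rpower_gt0 (INR n) (e / 2).
  apply: (Rmult_le_reg_r (Rpower (INR n) (e / 2))) => //.
  rewrite Rmult_assoc Rinv_l; last lra.
  have pa := Rpower_gt0 (INR n) (a - e / 2).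
  have := Rmult_le_compat_l _ _ _ (Rlt_le _ _ pa) b5.
  have := Rmult_le_compat_r (c / 3 * Rpower (INR n) (e / 2)) _ _ ltac:(lra) b3; lra.
have b1 : L y' * Rpower y' (- alpha) <= C * Rpower (INR n) ((/2 - h) * (h - alpha)).
  apply: Rle_trans (_ : C * (Rpower y' h * Rpower y' (- alpha)) <= _).
    by rewrite -Rmult_assoc; apply: Rmult_le_compat_r; [left; exact: Rpower_gt0 | lra].
  apply: Rmult_le_compat_l; first lra.
  rewrite -Rpower_plus.
  have yn : Rpower (INR n) (/2 - h) <= y' by apply: (proj1 (wh _ _)); lra.
  have := @Rpower_le_base_neg _ y' (h + - alpha) (conj (Rpower_gt0 _ _) yn) ltac:(lra).
  by rewrite Rpower_mult.
have b2 : T <= 3 * C * Rpower (INR n) ((/2 - h) * (h - alpha)) by lra.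
have ex : 1 + (/2 - h) * (h - alpha) <= a + e / 2.
  have : h * (alpha - h) <= h * 2 by apply: Rmult_le_compat_l; lra.
  by lra.
have b3 := Rpower_le_exp l0 ex; rewrite powz in b3.
have b4 : INR n * T <= INR n * (3 * C * Rpower (INR n) ((/2 - h) * (h - alpha))).
  by apply: Rmult_le_compat_l; lra.
apply: Rle_trans b4 _.
rewrite (_ : a + e = (a + e / 2) + (e / 2)); last lra.
rewrite Rpower_plus.
have p2 : 0 < 3 * C by lra.
have := Rmult_le_compat_l _ _ _ (Rlt_le _ _ p2) b3.
have := Rmult_le_compat_l _ _ _ (Rlt_le _ _ (Rpower_gt0 (INR n) (a + e / 2))) n1; lra.
Qed.

(** The quotient is a product of the (PL) ratio at (tau n ln n)^(1/2), the ratio of L at two points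
    a constant factor sqrt(tau) apart, and sqrt(tau)^(-alpha). The first two tend to 1. *)
Lemma tail_Kn tau : 0 < tau ->
  Un_cv (fun n => expected_large m P tau n / Kn L alpha n)
        (Rpower tau (- (alpha / 2))).
Proof.
move=> t0.
have st0 : 0 < sqrt tau by apply: sqrt_lt_R0.
pose u n := tail n (sqrt tau * root_nln n) /
  (L (sqrt tau * root_nln n) * Rpower (sqrt tau * root_nln n) (- alpha)).
pose v n := L (sqrt tau * root_nln n) / L (root_nln n).
have cu : Un_cv u 1.
  apply/ev_Un_cv => d d0.
  apply: ev_mp (@condPL_uniform d d0) _.
  apply: ev_mp (@root_nln_window eps0 (sqrt tau) (sqrt tau) ltac:(lra) st0) _.
  by apply: ev_all => n hw; apply; apply: hw; lra.
have cv : Un_cv v 1.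
  apply/ev_Un_cv => d d0; have [M hM] := proj2 HL _ st0 d d0.
  apply: ev_mp (ln_large 1) _.
  apply: ev_mp (@root_nln_window (1/4) 1 1 ltac:(lra) ltac:(lra)) _.
  apply: ev_mp (@Rpower_large (M + 1) (/2 - 1/4) ltac:(lra)) _.
  apply: ev_all => n h1 h2 l1; apply: hM.
  by have := proj1 (h2 (root_nln n) ltac:(lra)); lra.
set r := Rpower tau _.
have cr : Un_cv (fun _ : nat => r) r.
  by move=> d d0; exists 0%N => n _; rewrite /Rdist Rminus_diag Rabs_R0.
have := CV_mult _ _ _ _ (CV_mult _ _ _ _ cu cv) cr.
rewrite !Rmult_1_l => cw; apply/ev_Un_cv => d d0.
have /ev_Un_cv/(_ d d0) hcv := cw.
apply: (ev_mp hcv); apply: ev_mp (ln_large 1) _.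
apply: ev_all => n l1; rewrite (_ : _ / _ = u n * v n * r) // Kn_eq // /expected_large.
have X0 := root_nln_gt0 l1.
have L1 : 0 < L (root_nln n) by apply: (proj1 HL).
have L2 : 0 < L (sqrt tau * root_nln n) by apply: (proj1 HL); exact: Rmult_lt_0_compat.
have npos : 0 < INR n by rewrite INR_eq_exp; [exact: exp_pos | lra].
have p1 := Rpower_gt0 (root_nln n) (- alpha).
rewrite /u /v -Rpower_mult_distr //.
have -> : Rpower (sqrt tau) (- alpha) = r.
  by rewrite -Rpower_sqrt // Rpower_mult /r; congr (Rpower _ _); lra.
have r0 : 0 < r := Rpower_gt0 _ _.
by field; lra.
Qed.

End Asymptotics.

Lemma exp_le x y : x <= y -> exp x <= exp y.
Proof. by case=> [h|->]; [left; apply: exp_increasing | right]. Qed.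

Lemma exp_opp_small d : 0 < d -> exists C, forall x, C <= x -> exp (- x) <= d.
Proof.
move=> d0; exists (- ln d) => x hx; rewrite -[X in _ <= X](exp_ln _ d0).
by apply: exp_le; lra.
Qed.

Lemma nat_ceil x : 0 <= x -> exists s : nat, x <= INR s < x + 1.
Proof.
move=> x0; have [N hN] := INR_unbounded x.
have {hN} : x <= INR N by lra.
elim: N => [|N IH] h; first by exists 0%N; move: h => /=; lra.
have [h1|h1] := Rle_lt_dec x (INR N); first exact: IH.
by exists N.+1; split=> //; rewrite S_INR; lra.
Qed.

Lemma nat_floor x : 0 <= x -> exists s : nat, INR s <= x < INR s + 1.
Proof.
move=> x0; have [N hN] := INR_unbounded x.
elim: N hN => [|N IH] h; first by move: h => /=; lra.
have [h1|h1] := Rlt_le_dec x (INR N); first exact: IH.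
by exists N; split=> //; move: h; rewrite S_INR; lra.
Qed.

Lemma exp_pow x k : exp x ^ k = exp (x * INR k).
Proof.
elim: k => [|k IH]; first by rewrite /= Rmult_0_r exp_0.
by rewrite S_INR /= IH -exp_plus; congr exp; ring.
Qed.

Lemma pow_le_base y k : 0 <= y <= 1 -> 1 <= INR k -> y ^ k <= y.
Proof.
case: k => [|k] [y0 y1] k1; first by move: k1 => /=; lra.
have : y ^ k <= 1 by rewrite -(pow1 k); apply: pow_incr; lra.
by move/(Rmult_le_compat_l y _ _ y0) => /=; lra.
Qed.

(** The usual estimate reversed: 1/(1-p) = 1 + p/(1-p) <= exp(p/(1-b)). *)
Lemma exp_le_one_sub_pow p b k : 0 <= p <= b -> b < 1 ->
  exp (- (p * INR k / (1 - b))) <= (1 - p) ^ k.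
Proof.
move=> [p0 pb] b1.
have -> : - (p * INR k / (1 - b)) = - (p / (1 - b)) * INR k by field; lra.
rewrite -exp_pow; apply: pow_incr; split; first by left; exact: exp_pos.
rewrite exp_Ropp -(Rinv_inv (1 - p)); apply: Rinv_le_contravar.
  by apply: Rinv_0_lt_compat; lra.
apply: Rle_trans (exp_ineq1_le _).
have -> : / (1 - p) = 1 + p * / (1 - p) by field; lra.
have : / (1 - p) <= / (1 - b) by apply: Rinv_le_contravar; lra.
by move/(Rmult_le_compat_l p _ _ p0); rewrite /Rdiv; lra.
Qed.

(** As Y = (n/m)^(1/2) X, the condition Y >= (tau n ln n)^(1/2) reads X >= (tau m ln n)^(1/2), and s
    is the least integer satisfying it. *)
Lemma tail_mass_threshold n m (P : nat -> R) s tau : 0 < INR n -> 0 < INR m ->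
  0 <= tau -> 0 <= ln (INR n) ->
  sqrt (tau * (INR m * ln (INR n))) <= INR s < sqrt (tau * (INR m * ln (INR n))) + 1 ->
  tailY n m P (sqrt tau * root_nln n) =
  tail_mass (R := Rdefinitions.R) m P s.
Proof.
move=> n0 m0 t0 l0 [s1 s2]; apply: tailY_tail_mass => k.
have nm0 : 0 < INR n / INR m by apply: Rdiv_lt_0_compat.
have sc0 : 0 < scaleY n m by apply: sqrt_lt_R0.
have -> : sqrt tau * root_nln n =
    scaleY n m * sqrt (tau * (INR m * ln (INR n))).
  have ml : 0 <= INR m * ln (INR n) by apply: Rmult_le_pos; lra.
  have nl : 0 <= INR n * ln (INR n) by apply: Rmult_le_pos; lra.
  have tml : 0 <= tau * (INR m * ln (INR n)) by apply: Rmult_le_pos.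
  rewrite /scaleY /root_nln -!sqrt_mult //; try lra.
  by congr sqrt; field; lra.
split=> [h|/leP/le_INR h].
  have h1 := Rmult_le_reg_l _ _ _ sc0 h.
  rewrite -ltnS; apply/ltP/INR_lt; rewrite S_INR; lra.
by apply: Rmult_le_compat_l; lra.
Qed.

(** * The two one-sided bounds for fixed tau *)

Section Tails.
Variables (alpha : R) (m : nat -> nat) (P : nat -> nat -> R) (L : R -> R) (eps0 beta : R).
Hypothesis Halpha : 1 < alpha < 2.
Hypothesis HP : forall n, is_prob_law (m n) (P n).
Hypothesis Hm : forall M : nat, exists N, forall n, (N <= n)%N -> (M <= m n)%N.
Hypothesis HL : slowly_varying L.
Hypothesis Heps0 : 0 < eps0 < /2.
Hypothesis HA : condA m P.
Hypothesis HPL : condPL m P alpha L eps0.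
Hypothesis Hbeta : Rmax (2 - alpha) (alpha - 1) < beta.
Hypothesis Hmbeta : exists c N, 0 < c /\
  forall n, (N <= n)%N -> c * Rpower (INR n) beta <= INR (m n).

Local Notation a := (1 - alpha / 2).
Local Notation many := (expected_large m P).

Lemma many_bounds tau e : 0 < tau -> 0 < e ->
  exists b, 0 < b /\ eventually (fun n =>
    b * Rpower (INR n) (a - e) <= many tau n <= 3 * b * Rpower (INR n) (a + e)).
Proof.
move=> t0 e0; pose r := Rpower tau (- (alpha / 2)).
have r0 : 0 < r := Rpower_gt0 _ _.
exists (r / 2); split; first lra.
have /ev_Un_cv/(_ (r/2) ltac:(lra)) h := tail_Kn HL Heps0 HPL t0.
apply: (ev_mp h).
apply: ev_mp (Kn_bounds Halpha HP HL Heps0 HPL e0) _.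
apply: ev_all => n [k1 k2] /Rabs_def2; rewrite -/r => -[h1 h2].
have K0 : 0 < Kn L alpha n by apply: Rlt_le_trans k1; exact: Rpower_gt0.
have e1 : many tau n = many tau n / Kn L alpha n * Kn L alpha n by field; lra.
have b1 := Rmult_le_compat_l (r/2) _ _ ltac:(lra) k1.
have b2 := Rmult_le_compat_l (3 * (r/2)) _ _ ltac:(lra) k2.
have b3 : r / 2 * Kn L alpha n <= many tau n / Kn L alpha n * Kn L alpha n.
  by apply: Rmult_le_compat_r; lra.
have b4 : many tau n / Kn L alpha n * Kn L alpha n <= 3 * (r / 2) * Kn L alpha n.
  by apply: Rmult_le_compat_r; lra.
lra.
Qed.

Lemma m_ev_gt0 : eventually (fun n => (0 < m n)%N).
Proof. by have [N hN] := Hm 1; exists N. Qed.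

Lemma clique_number_lower_tail tau eta d : a < tau -> 0 < eta <= 1 -> 0 < d ->
  eventually (fun n => rig_prob (P n) (fun f : config n (m n) =>
    Rltb (INR (clique_number f)) ((1 - 2 * eta) * many tau n)) < d).
Proof.
move=> at0 [e0 e1] d0; have a0 : 0 < a by lra.
(* Half the gap leaves n^(a + e - tau) <= n^(-(tau - a)/2), and e <= a/2 keeps n^(a - e)
   unbounded. *)
pose e := Rmin ((tau - a) / 2) (a / 2).
have he : 0 < e by apply: Rmin_glb_lt; lra.
have he1 : e <= (tau - a) / 2 by apply: Rmin_l.
have he2 : e <= a / 2 by apply: Rmin_r.
have [b [b0 hb]] := @many_bounds tau e ltac:(lra) he.
have [C hC] := @exp_opp_small (d / 3) ltac:(lra).
apply: (ev_mp hb); apply: ev_mp (ln_large 1) _; apply: ev_mp m_ev_gt0 _.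
apply: ev_mp (@Rpower_large (C * 8 / (b * eta ^ 2)) (a - e) ltac:(lra)) _.
apply: ev_mp (@Rpower_large (9 * b / (eta * d)) ((tau - a) / 2) ltac:(lra)) _.
apply: ev_all => n g1 g2 m0 l1 [q1 q2].
have n0 : 0 < INR n by rewrite INR_eq_exp; [exact: exp_pos | lra].
have M0 : 0 < INR (m n) by apply: lt_0_INR; apply/ltP.
have [s hs] := nat_ceil (sqrt_pos (tau * (INR (m n) * ln (INR n)))).
have tE := @tail_mass_threshold n (m n) (P n) s tau n0 M0 ltac:(lra) ltac:(lra) hs.
have p0 : 0 < b * Rpower (INR n) (a - e) by apply: Rmult_lt_0_compat => //; exact: Rpower_gt0.
have := @rig_lower n (m n) s (P n) eta (HP n) (conj e0 e1).
rewrite -tE -/(many tau n) => /(_ ltac:(lra)) h.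
apply: Rle_lt_trans h _.
have e20 : 0 < eta ^ 2 by apply: pow_lt.
have T1 : exp (- (many tau n * eta ^ 2 / 8)) <= d / 3.
  apply: hC; have := Rmult_le_compat_l (b * eta ^ 2) _ _ ltac:(have := Rmult_lt_0_compat _ _ b0 e20; lra) g2.
  have -> : b * eta ^ 2 * (C * 8 / (b * eta ^ 2)) = 8 * C by field; lra.
  by have := Rmult_le_compat_r (eta ^ 2) _ _ ltac:(lra) q1; lra.
have T2 : many tau n * exp (- (INR s ^ 2 / INR (m n))) / eta <= d / 3.
  have s2 : tau * ln (INR n) <= INR s ^ 2 / INR (m n).
    apply: (Rmult_le_reg_r (INR (m n))) => //.
    rewrite /Rdiv (Rmult_assoc (INR s ^ 2)) Rinv_l; last lra.
    have ml : 0 <= tau * (INR (m n) * ln (INR n)).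
      by apply: Rmult_le_pos; [lra | apply: Rmult_le_pos; lra].
    have := pow_incr _ _ 2 (conj (sqrt_pos _) (proj1 hs)).
    by rewrite pow2_sqrt //; lra.
  have s3 : exp (- (INR s ^ 2 / INR (m n))) <= Rpower (INR n) (- tau).
    by apply: exp_le; lra.
  have s4 : many tau n * exp (- (INR s ^ 2 / INR (m n))) <=
      3 * b * Rpower (INR n) (a + e) * Rpower (INR n) (- tau).
    by apply: Rmult_le_compat => //; [lra | left; exact: exp_pos].
  have s5 : Rpower (INR n) (a + e) * Rpower (INR n) (- tau) <= / Rpower (INR n) ((tau - a) / 2).
    by rewrite -Rpower_plus -Rpower_Ropp; apply: Rpower_le_exp; lra.
  have pd : 0 < eta * d by apply: Rmult_lt_0_compat.
  have s6 : 3 * b * / Rpower (INR n) ((tau - a) / 2) <= eta * d / 3.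
    have h : 0 < 9 * b / (eta * d) by apply: Rdiv_lt_0_compat; lra.
    have := Rinv_le_contravar _ _ h g1.
    move/(Rmult_le_compat_l (3 * b) _ _ ltac:(lra)).
    by have -> : 3 * b * / (9 * b / (eta * d)) = eta * d / 3 by field; lra.
  apply: (Rmult_le_reg_r eta) => //.
  rewrite /Rdiv Rmult_assoc Rinv_l; last lra.
  have := Rmult_le_compat_l (3 * b) _ _ ltac:(lra) s5; lra.
lra.
Qed.

(** The constant in m = Omega(n^beta) is traded for a loss h in the exponent. *)
Lemma m_growth C h : 0 < h -> eventually (fun n =>
  [/\ C <= ln (INR (m n)), 1 <= INR (m n),
      (beta - h) * ln (INR n) <= ln (INR (m n)) & C <= INR (m n)]).
Proof.
move=> h0; have [c [N [c0 hN]]] := Hmbeta.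
have hM : eventually (fun n => c * Rpower (INR n) beta <= INR (m n)) by exists N.
have b0 : 0 < beta by have := Rmax_l (2 - alpha) (alpha - 1); lra.
apply: (ev_mp hM); apply: ev_mp (@ln_large (- ln c / h) ) _.
apply: ev_mp (@ln_large ((Rabs C - ln c) / beta)) _.
apply: ev_mp (@Rpower_large ((1 + Rabs C) / c) beta b0) _.
apply: ev_all => n h3 h2 h1 hm.
have C1 := Rle_abs C; have C0 := Rabs_pos C.
have h1' : - ln c <= h * ln (INR n).
  have := Rmult_le_compat_l h _ _ ltac:(lra) h1.
  by rewrite (_ : h * (- ln c / h) = - ln c); [lra | field; lra].
have h2' : Rabs C - ln c <= beta * ln (INR n).
  have := Rmult_le_compat_l beta _ _ ltac:(lra) h2.
  by rewrite (_ : beta * ((Rabs C - ln c) / beta) = Rabs C - ln c); [lra | field; lra].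
have h3' : 1 + Rabs C <= c * Rpower (INR n) beta.
  have := Rmult_le_compat_l c _ _ ltac:(lra) h3.
  by rewrite (_ : c * ((1 + Rabs C) / c) = 1 + Rabs C); [lra | field; lra].
have p0 := Rpower_gt0 (INR n) beta.
have := ln_le_ln (Rmult_lt_0_compat _ _ c0 p0) hm.
rewrite ln_mult // /Rpower ln_exp => hl.
split; lra.
Qed.

Lemma clique_number_upper_tail tau eta : 0 < tau < a -> 0 < eta <= 1 ->
  exists g, 0 < g /\ forall d, 0 < d ->
  eventually (fun n => rig_prob (P n) (fun f : config n (m n) =>
    Rltb ((1 + eta) * many tau n + 2 * Rpower (INR n) (a - g))
         (INR (clique_number f))) < d).
Proof.
move=> [t0 ta] [e0 e1].
have bl := Rmax_l (2 - alpha) (alpha - 1); have br := Rmax_r (2 - alpha) (alpha - 1).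
(* Clique size i ~ n^(a-g), attribute degrees at most D ~ n^(a-2g), overlaps at
   most t ~ n^g.  The three bounds on g guarantee a - 3g > 0,
   i * n^-(tau+g) >= n^g, and D well above the expected attribute degree
   sqrt(n/m). *)
pose g := Rmin (a / 4) (Rmin ((a - tau) / 3) ((a - (1 - beta) / 2) / 4)).
have g0 : 0 < g by apply: Rmin_glb_lt; [lra | apply: Rmin_glb_lt; lra].
have ga : g <= a / 4 by apply: Rmin_l.
have gt : g <= (a - tau) / 3.
  by apply: Rle_trans (Rmin_r _ _) _; apply: Rmin_l.
have gb : g <= (a - (1 - beta) / 2) / 4.
  by apply: Rle_trans (Rmin_r _ _) _; apply: Rmin_r.
have g1 : g < 1 / 4 by lra.
exists g; split=> // d d0.
(* h solves (2h - beta)/2 = -a - h: from s^2/m^2 <= (ln n)/m <= n^(2h - beta) follows s/m <= n^(-a -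
   h), which beats the product i t of order n^a. *)
pose h := (beta - 2 * a) / 4; have h0 : 0 < h by rewrite /h; lra.
(* (tau + g)(1 - e')^2 >= (tau + g)(1 - 2e') = tau + g/2, so two factors 1/(1 - e'), one from p and
   one from [exp_le_one_sub_pow], fit between tau + g/2 and tau + g. *)
pose e' := g / (4 * (tau + g)).
have e'0 : 0 < e' by apply: Rdiv_lt_0_compat; lra.
have e'4 : e' <= / 4.
  by apply: (Rmult_le_reg_r (4 * (tau + g))); [lra | rewrite /e' /Rdiv Rmult_assoc Rinv_l; lra].
have e'g : e' * (4 * (tau + g)) = g by rewrite /e'; field; lra.
(* With exp(lam) = m^(1/2) n^(-w) this gives (n/m)^(1/2) exp(lam) = n^(a - 3g), smaller than D by a
   factor n^g; w < beta/2 leaves lam at least c3 ln m. *)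
pose w := / 2 - (a - 3 * g).
have w0 : 0 < w by rewrite /w; lra.
have wb : w < beta / 2 by rewrite /w; lra.
pose dl := beta / 2 - w.
pose c3 := dl / (2 * beta).
have c30 : 0 < c3 by apply: Rdiv_lt_0_compat; rewrite /dl; lra.
have [CA [NA hCA]] := HA; pose CA' := Rmax CA 0.
have hA : eventually (fun n => EY n (m n) (P n) <= CA') .
  by exists NA => n Nn; apply: Rle_trans (hCA n Nn) (Rmax_l _ _).
have CA0 : 0 <= CA' := Rmax_r _ _.
have d5 : 0 < d / 5 by lra.
have [Cd hCd] := exp_opp_small d5.
have [Cd4 hCd4] := @exp_opp_small (Rmin 1 (d / 5) / 4) ltac:(have := Rmin_glb_lt _ _ _ Rlt_0_1 d5; lra).
have [C2 hC2] := @exp_opp_small (1 / 2) ltac:(lra).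
(* A lower bound to be imposed on (m ln n)^(1/2): 6/g lets the rounding of s cost only g/2 in s^2/(m
   ln n), and the last entry makes the Bernoulli subset reach size s with probability at least
   1/2. *)
pose CZ := Rmax 1 (Rmax (6 / g) (Rmax 0 C2 * 8 / (e' ^ 2 * sqrt tau))).
have [b [b0 hb]] := @many_bounds tau (a / 2) t0 ltac:(lra).
apply: (ev_mp hA); apply: (ev_mp hb); apply: ev_mp (ln_large (Rmax 1 Cd4)) _.
apply: ev_mp (@m_growth (CZ ^ 2) (Rmin h dl) ltac:(apply: Rmin_glb_lt; rewrite /dl; lra)) _.
apply: ev_mp (@Rpower_large (Cd * 8 / (b * eta ^ 2)) (a - a / 2) ltac:(lra)) _.
apply: ev_mp (@ln_le_Rpower 1 h h0) _.
apply: ev_mp (@Rpower_large (Rmax 32 (2 / e')) (h / 2) ltac:(lra)) _.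
apply: ev_mp (@ln_le_Rpower 96 g g0) _.
apply: ev_mp (@Rpower_large (Rmax 1 ((CA' + 2) / c3)) g g0) _.
apply: ev_mp (@Rpower_large (Rmax 1 Cd) (a - 3 * g) ltac:(lra)) _.
apply: ev_mp (@Rpower_large 2 (a - g) ltac:(lra)) _.
apply: ev_mp (@Rpower_large 1 (a - 2 * g) ltac:(lra)) _.
apply: ev_all => n f1 f2 f3 f4 f5 f6 f7 f8 [f9 f10 f11 f12] f13 [f14 f15] f16.
have f3a := Rle_trans _ _ _ (Rmax_l _ _) f3; have f3b := Rle_trans _ _ _ (Rmax_r _ _) f3.
have f4a := Rle_trans _ _ _ (Rmax_l _ _) f4; have f4b := Rle_trans _ _ _ (Rmax_r _ _) f4.
have f6a := Rle_trans _ _ _ (Rmax_l _ _) f6; have f6b := Rle_trans _ _ _ (Rmax_r _ _) f6.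
have l1 := Rle_trans _ _ _ (Rmax_l _ _) f13; have lC := Rle_trans _ _ _ (Rmax_r _ _) f13.
clear f3 f4 f6 f13.
have n0 : 0 < INR n by rewrite INR_eq_exp; [exact: exp_pos | lra].
have nE : INR n = exp (ln (INR n)) by rewrite exp_ln.
have M0 : 0 < INR (m n) by lra.
have m0 : (0 < m n)%N by apply/ltP/INR_lt.
have ME : INR (m n) = exp (ln (INR (m n))) by rewrite exp_ln.
have Ele x y : x <= y -> Rpower (INR n) x <= Rpower (INR n) y.
  by apply: Rpower_le_exp; lra.
have EP x y := Rpower_plus x y (INR n).
have E0 x := Rpower_gt0 (INR n) x.
have EV x := Rpower_Ropp (INR n) x.
have CZ1 : 1 <= CZ := Rmax_l _ _.
have CZ2 : 6 / g <= CZ by apply: Rle_trans (Rmax_l _ _) (Rmax_r _ _).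
have CZ3 : Rmax 0 C2 * 8 / (e' ^ 2 * sqrt tau) <= CZ by apply: Rle_trans (Rmax_r _ _) (Rmax_r _ _).
pose Z := INR (m n) * ln (INR n).
have ZM : INR (m n) <= Z by have := Rmult_le_compat_l _ _ _ (Rlt_le _ _ M0) l1; rewrite /Z; lra.
have Z0 : 0 < Z by lra.
have sZ : CZ <= sqrt Z.
  rewrite -(sqrt_pow2 CZ); last lra.
  by apply: sqrt_le_1_alt; lra.
have sZZ : sqrt Z * sqrt Z = Z by apply: sqrt_sqrt; lra.
have [s hs] := nat_ceil (sqrt_pos (tau * Z)).
have [i hi] := nat_floor (Rlt_le _ _ (E0 (a - g))).
have [D hD] := nat_ceil (Rlt_le _ _ (E0 (a - 2 * g))).
have [t ht] := nat_ceil (Rlt_le _ _ (E0 g)).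
have tE := @tail_mass_threshold n (m n) (P n) s tau n0 M0 ltac:(lra) ltac:(lra) hs.
have sx : sqrt (tau * Z) = sqrt tau * sqrt Z by apply: sqrt_mult; lra.
have st0 : 0 < sqrt tau by apply: sqrt_lt_R0.
have st1 : sqrt tau <= 1 by rewrite -sqrt_1; apply: sqrt_le_1_alt; lra.
have stt : sqrt tau * sqrt tau = tau by apply: sqrt_sqrt; lra.
have s0 : 0 < INR s.
  by apply: Rlt_le_trans (proj1 hs); rewrite sx; apply: Rmult_lt_0_compat; lra.
have ssq : INR s * INR s <= (tau + g / 2) * Z.
  have x1 : INR s <= sqrt tau * sqrt Z + 1 by lra.
  have x2 : sqrt tau * sqrt Z <= sqrt Z.
    by have := Rmult_le_compat_r (sqrt Z) _ _ (sqrt_pos Z) st1; lra.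
  have x3 : INR s * INR s <= (sqrt tau * sqrt Z + 1) * (sqrt tau * sqrt Z + 1).
    by apply: Rmult_le_compat; lra.
  have x4 : (sqrt tau * sqrt Z) * (sqrt tau * sqrt Z) = tau * Z.
    by rewrite -[X in _ = X * _]stt -[X in _ = _ * X]sZZ; ring.
  have x5 : 6 <= g * sqrt Z.
    have := Rmult_le_compat_l g _ _ ltac:(lra) (Rle_trans _ _ _ CZ2 sZ).
    by rewrite (_ : g * (6 / g) = 6) //; field; lra.
  have x6 := Rmult_le_compat_r (sqrt Z) _ _ (sqrt_pos Z) x5.
  have x7 : g * sqrt Z * sqrt Z = g * Z by rewrite Rmult_assoc sZZ.
  lra.
have key : INR s / INR (m n) <= Rpower (INR n) (- a - h).
  have y1 : INR s * INR s <= Z.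
    by apply: Rle_trans ssq _; have := Rmult_le_compat_r Z (tau + g/2) 1 ltac:(lra) ltac:(lra); lra.
  have y2 : Z / (INR (m n) * INR (m n)) = ln (INR n) * / INR (m n) by rewrite /Z; field; lra.
  have y3 : / INR (m n) <= Rpower (INR n) (h - beta).
    rewrite (_ : h - beta = - (beta - h)) ?EV; last lra.
    apply: Rinv_le_contravar; first exact: E0.
    rewrite ME; apply: exp_le; apply: Rle_trans f11; apply: Rmult_le_compat_r; first lra.
    by have := Rmin_l h dl; lra.
  have y4 : ln (INR n) * / INR (m n) <= Rpower (INR n) h * Rpower (INR n) (h - beta).
    apply: Rmult_le_compat => //; try lra.
    by left; apply: Rinv_0_lt_compat.
  have y5 : Rpower (INR n) h * Rpower (INR n) (h - beta) =
      Rpower (INR n) (- a - h) * Rpower (INR n) (- a - h).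
    by rewrite -!EP; congr Rpower; rewrite /h; lra.
  apply: Rsqr_incr_0_var; last by left; exact: E0.
  rewrite /Rsqr -y5; apply: Rle_trans y4; rewrite -y2.
  have -> : INR s / INR (m n) * (INR s / INR (m n)) =
      INR s * INR s / (INR (m n) * INR (m n)) by field; lra.
  apply: Rmult_le_compat_r => //; left; apply: Rinv_0_lt_compat.
  exact: Rmult_lt_0_compat.
pose p := INR s / (INR (m n) * (1 - e')).
have pM : INR s <= (1 - e') * (INR (m n) * p).
  by rewrite /p; right; field; lra.
have p0 : 0 <= p by apply: Rlt_le; apply: Rdiv_lt_0_compat => //; apply: Rmult_lt_0_compat; lra.
have i1e : / (1 - e') <= 2.
  by rewrite -(Rinv_inv 2); apply: Rinv_le_contravar; lra.
have pkey : p <= 2 * Rpower (INR n) (- a - h).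
  have -> : p = INR s / INR (m n) * / (1 - e') by rewrite /p; field; lra.
  rewrite Rmult_comm; apply: Rmult_le_compat => //.
  - by left; apply: Rinv_0_lt_compat; lra.
  - by apply: Rlt_le; apply: Rdiv_lt_0_compat.
have Eh2 : Rpower (INR n) (- (h / 2)) <= e' / 2 /\ Rpower (INR n) (- (h / 2)) <= / 32.
  rewrite EV; split; last by apply: Rinv_le_contravar; lra.
  rewrite (_ : e' / 2 = / (2 / e')); last by field; lra.
  by apply: Rinv_le_contravar => //; apply: Rdiv_lt_0_compat; lra.
have pe' : p <= e'.
  by have := Ele (- a - h) (- (h / 2)) ltac:(lra); lra.
have i0 : 1 <= INR i.
  have : (0 < i)%N by rewrite lt0n; apply/eqP => i0; move: hi; rewrite i0 /=; lra.
  by move/ltP/(le_INR 1).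
have D0 : (0 < D)%N by apply/ltP/INR_lt; rewrite /=; lra.
pose lam := / 2 * ln (INR (m n)) - w * ln (INR n).
have lamc : c3 * ln (INR (m n)) <= lam.
  have z1 : c3 * beta = dl / 2 by rewrite /c3; field; lra.
  have z2 : c3 <= / 4.
    by apply: (Rmult_le_reg_r beta); [lra | rewrite z1 /dl; lra].
  have hl := Rmin_r h dl; have hp : 0 < Rmin h dl by apply: Rmin_glb_lt; rewrite /dl; lra.
  have z3 := Rmult_le_compat_l (/ 2 - c3) _ _ ltac:(lra) f11.
  have z4 : w <= (/ 2 - c3) * (beta - Rmin h dl).
    have : c3 * (beta - Rmin h dl) <= c3 * beta by apply: Rmult_le_compat_l; lra.
    by rewrite z1 /dl; rewrite /dl in hl; lra.
  have z5 := Rmult_le_compat_r (ln (INR n)) _ _ ltac:(lra) z4.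
  by rewrite /lam; lra.
have lM1 : 1 <= ln (INR (m n)).
  by have := pow_R1_Rle CZ 2 CZ1; lra.
have lam0 : 0 <= lam by have := Rmult_lt_0_compat _ _ c30 (Rlt_le_trans _ _ _ Rlt_0_1 lM1); lra.
have C2b : exp (- (INR (m n) * p * e' ^ 2 / 8)) <= 1 / 2.
  apply: hC2.
  have v0 : 0 < e' ^ 2 by apply: pow_lt.
  have v1 : INR s <= INR (m n) * p.
    have u0 : 0 <= INR (m n) * p by apply: Rmult_le_pos; lra.
    by have := Rmult_le_pos e' _ ltac:(lra) u0; lra.
  have v2 : Rmax 0 C2 * 8 <= e' ^ 2 * (sqrt tau * sqrt Z).
    have vv : 0 < e' ^ 2 * sqrt tau by apply: Rmult_lt_0_compat.
    have := Rmult_le_compat_l _ _ _ (Rlt_le _ _ vv) (Rle_trans _ _ _ CZ3 sZ).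
    by rewrite (_ : _ * (_ / _) = Rmax 0 C2 * 8); [lra | field; lra].
  have v3 : e' ^ 2 * (sqrt tau * sqrt Z) <= e' ^ 2 * (INR (m n) * p).
    by apply: Rmult_le_compat_l; lra.
  by have := Rmax_r 0 C2; lra.
have := @rig_upper n (m n) s i t D (P n) eta e' p lam (HP n)
  ltac:(lra) ltac:(lra) ltac:(lra) pM C2b D0 lam0.
rewrite -tE -/(many tau n) mean_density_EY // => hU.
apply: Rle_lt_trans (_ : rig_prob (P n) (fun f : config n (m n) =>
  Rltb ((1 + eta) * many tau n + 2 * INR i) (INR (clique_number f))) < _).
  apply: rig_prob_le => // f; rewrite /Rltb; case: Rlt_dec => // h1 _.
  by case: Rlt_dec => // h2; case: h2; lra.
apply: Rle_lt_trans hU _.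
have e20 : 0 < eta ^ 2 by apply: pow_lt.
have T0 : exp (- (many tau n * eta ^ 2 / 8)) <= d / 5.
  apply: hCd; have := Rmult_le_compat_l (b * eta ^ 2) _ _ ltac:(have := Rmult_lt_0_compat _ _ b0 e20; lra) f8.
  have -> : b * eta ^ 2 * (Cd * 8 / (b * eta ^ 2)) = 8 * Cd by field; lra.
  by have := Rmult_le_compat_r (eta ^ 2) _ _ ltac:(lra) f14; lra.
(* m n may grow faster than any power of n, so the exponential tilt lam must be
   of order ln (m n) for the union bound over attributes. *)
have T1 : INR (m n) * exp (scaleY n (m n) * EY n (m n) (P n) * exp lam - lam * INR D) <= d / 5.
  have sc : scaleY n (m n) * exp lam = Rpower (INR n) (a - 3 * g).
    rewrite /scaleY -Rpower_sqrt; last by apply: Rdiv_lt_0_compat.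
    have iM := Rinv_0_lt_compat _ M0.
    rewrite /Rpower /Rdiv ln_mult // ln_Rinv // -exp_plus; congr exp.
    by rewrite /lam /w; lra.
  have scE : scaleY n (m n) * EY n (m n) (P n) * exp lam <= CA' * Rpower (INR n) (a - 3 * g).
    rewrite Rmult_assoc (Rmult_comm (EY _ _ _)) -Rmult_assoc sc Rmult_comm.
    by apply: Rmult_le_compat_r; [left; exact: E0 | lra].
  rewrite {1}ME -exp_plus; apply: Rle_trans (hCd _ f3b); apply: exp_le.
  have DH : Rpower (INR n) (a - 3 * g) * Rpower (INR n) g <= INR D.
    by rewrite -EP (_ : a - 3 * g + g = a - 2 * g); lra.
  set G := Rpower (INR n) (a - 3 * g) in DH f3a scE *; set H := Rpower (INR n) g in DH f4b.
  have q1 : CA' + 2 <= c3 * H.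
    have := Rmult_le_compat_l c3 _ _ ltac:(lra) f4b.
    by rewrite (_ : c3 * ((CA' + 2) / c3) = CA' + 2); [lra | field; lra].
  set lM := ln (INR (m n)) in lamc lM1 *.
  have q2 : (CA' + 2) * (lM * G) <= c3 * H * (lM * G).
    by apply: Rmult_le_compat_r => //; apply: Rmult_le_pos; lra.
  have q3 : c3 * lM * (G * H) <= lam * INR D.
    apply: Rmult_le_compat => //; try (apply: Rmult_le_pos; lra).
    by apply: Rmult_le_pos; left; exact: E0.
  have q4 : G <= lM * G by have := Rmult_le_compat_r G _ _ ltac:(lra) lM1; lra.
  have q5 : lM <= lM * G by have := Rmult_le_compat_l lM _ _ ltac:(lra) f3a; lra.
  have q6 : CA' * G <= CA' * (lM * G) by apply: Rmult_le_compat_l.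
  lra.
have n2 : INR n ^ 2 = exp (2 * ln (INR n)).
  by rewrite {1}nE exp_pow; congr exp; rewrite /= ; ring.
have pis : p * INR s / (1 - e') <= (tau + g) * ln (INR n).
  have r1 : p * INR s / (1 - e') = INR s * INR s / INR (m n) / ((1 - e') * (1 - e')).
    by rewrite /p; field; lra.
  have r2 : INR s * INR s / INR (m n) <= (tau + g / 2) * ln (INR n).
    apply: (Rmult_le_reg_r (INR (m n))) => //.
    by rewrite /Rdiv (Rmult_assoc (INR s * INR s)) Rinv_l; [rewrite /Z in ssq; lra | lra].
  have r3 : 0 < (1 - e') * (1 - e') by apply: Rmult_lt_0_compat; lra.
  apply: (Rmult_le_reg_r ((1 - e') * (1 - e'))) => //.
  rewrite r1 /Rdiv (Rmult_assoc (_ * / INR (m n))) Rinv_l; last lra.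
  have r4 : tau + g / 2 <= (tau + g) * ((1 - e') * (1 - e')).
    have : 0 <= (tau + g) * (e' * e') by apply: Rmult_le_pos; [lra | apply: Rmult_le_pos; lra].
    lra.
  have := Rmult_le_compat_r (ln (INR n)) _ _ ltac:(lra) r4; lra.
have ps0 : 0 <= p * INR s by apply: Rmult_le_pos; lra.
have Cd1 : 4 * exp (- ln (INR n)) <= Rmin 1 (d / 5) by have := hCd4 _ lC; lra.
have Cd2 : 4 * exp (- ln (INR n)) <= 1 by apply: Rle_trans Cd1 (Rmin_l _ _).
have Cd3 : 4 * exp (- ln (INR n)) <= d / 5 by apply: Rle_trans Cd1 (Rmin_r _ _).
have T2 : INR n ^ 2 * (2 * exp (p * INR s - INR t / 2)) <= d / 5.
  have -> : INR n ^ 2 * (2 * exp (p * INR s - INR t / 2)) =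
      2 * exp (2 * ln (INR n) + (p * INR s - INR t / 2)) by rewrite n2 exp_plus; ring.
  have u1 : p * INR s <= p * INR s / (1 - e').
    have : 1 <= / (1 - e') by rewrite -{1}Rinv_1; apply: Rinv_le_contravar; lra.
    by move/(Rmult_le_compat_l _ _ _ ps0); rewrite /Rdiv; lra.
  have u2 : (tau + g) * ln (INR n) <= ln (INR n).
    by have := Rmult_le_compat_r (ln (INR n)) (tau + g) 1 ltac:(lra) ltac:(lra); lra.
  have := @exp_le (2 * ln (INR n) + (p * INR s - INR t / 2)) (- ln (INR n)) ltac:(lra).
  by have := exp_pos (- ln (INR n)); lra.
pose A := p * (INR i ^ 2 * INR t) / INR D - INR i / (4 * INR D).
pose B := (1 - p) ^ s * (INR i / 2).
have Dp : 0 < INR D by apply: lt_0_INR; apply/ltP.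
have iE : Rpower (INR n) (a - g) / 2 <= INR i by lra.
(* A = (i/D)(p i t - 1/4), where p i t <= 1/8 and i/D >= n^g/4. *)
have A1 : A <= - (Rpower (INR n) g / 32).
  have t2 : INR t <= 2 * Rpower (INR n) g by lra.
  have pit : p * (INR i * INR t) <= / 8.
    have w1 : INR i * INR t <= Rpower (INR n) (a - g) * (2 * Rpower (INR n) g).
      by apply: Rmult_le_compat; lra.
    have w2 : p * (INR i * INR t) <= 2 * Rpower (INR n) (- a - h) *
        (Rpower (INR n) (a - g) * (2 * Rpower (INR n) g)).
      by apply: Rmult_le_compat => //; apply: Rmult_le_pos; lra.
    have w3 : 2 * Rpower (INR n) (- a - h) * (Rpower (INR n) (a - g) * (2 * Rpower (INR n) g))
        = 4 * Rpower (INR n) (- h).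
      have -> : - h = (- a - h) + ((a - g) + g) by lra.
      by rewrite !EP; ring.
    by have := Ele (- h) (- (h / 2)) ltac:(lra); lra.
  have -> : A = (INR i / INR D) * (p * (INR i * INR t) - / 4) by rewrite /A; field; lra.
  have iD : Rpower (INR n) g / 4 <= INR i / INR D.
    apply: (Rmult_le_reg_r (INR D)) => //.
    rewrite /Rdiv (Rmult_assoc (INR i)) Rinv_l; last lra.
    have : Rpower (INR n) g * INR D <= Rpower (INR n) g * (2 * Rpower (INR n) (a - 2 * g)).
      by apply: Rmult_le_compat_l; lra.
    have -> : Rpower (INR n) g * (2 * Rpower (INR n) (a - 2 * g)) = 2 * Rpower (INR n) (a - g).
      by have -> : a - g = g + (a - 2 * g) by [lra]; rewrite !EP; ring.
    lra.
  have iD0 : 0 <= INR i / INR D by apply: Rlt_le; apply: Rdiv_lt_0_compat; lra.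
  have := Rmult_le_compat_l _ _ _ iD0 pit; lra.
have B1 : Rpower (INR n) g / 32 <= B.
  have pi1 : Rpower (INR n) (- (tau + g)) <= (1 - p) ^ s.
    apply: Rle_trans (@exp_le_one_sub_pow p e' s ltac:(lra) ltac:(lra)).
    by apply: exp_le; lra.
  have v1 : Rpower (INR n) (- (tau + g)) * (Rpower (INR n) (a - g) / 4) <= B.
    by apply: Rmult_le_compat; try lra; left; exact: E0.
  have v2 : Rpower (INR n) (- (tau + g)) * Rpower (INR n) (a - g) = Rpower (INR n) (a - tau - 2 * g).
    by rewrite -EP; congr Rpower; lra.
  have := Ele g (a - tau - 2 * g) ltac:(lra); have := E0 g; lra.
(* n^g >= 96 ln n makes exp(-n^g/32) at most n^(-3), so the base is at most 4/n <= 1 and a single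
   factor of the i-th power suffices. *)
have T3 : (INR n ^ 2 * (2 * (exp A + exp (- B)))) ^ i <= d / 5.
  set y := _ * _.
  have y1 : 0 <= y.
    have := exp_pos A; have := exp_pos (- B) => k1 k2.
    by apply: Rmult_le_pos; [rewrite n2; left; exact: exp_pos | lra].
  have y2 : y <= 4 * exp (- ln (INR n)).
    have k1 := exp_le A1; have k2 := @exp_le (- B) (- (Rpower (INR n) g / 32)) ltac:(lra).
    have k3 : y <= exp (2 * ln (INR n)) * (4 * exp (- (Rpower (INR n) g / 32))).
      by rewrite /y n2; apply: Rmult_le_compat_l; [left; exact: exp_pos | lra].
    apply: Rle_trans k3 _.
    have -> : exp (2 * ln (INR n)) * (4 * exp (- (Rpower (INR n) g / 32))) =
        4 * exp (2 * ln (INR n) + - (Rpower (INR n) g / 32)) by rewrite exp_plus; ring.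
    by apply: Rmult_le_compat_l; [lra | apply: exp_le; lra].
  by apply: Rle_trans (pow_le_base (conj y1 _) i0) _; lra.
rewrite -/A -/B; lra.
Qed.

End Tails.

(** * Letting tau approach a from both sides *)

Lemma scaled_threshold alpha a r (tau := a * Rpower r (- (2 / alpha))) :
  1 < alpha < 2 -> 0 < a -> 0 < r ->
  0 < tau /\ Rpower tau (- (alpha / 2)) = Rpower a (- (alpha / 2)) * r.
Proof.
move=> al a0 r0; have p0 := Rpower_gt0 r (- (2 / alpha)).
split; first exact: Rmult_lt_0_compat.
rewrite /tau -Rpower_mult_distr // Rpower_mult.
by rewrite (_ : - (2 / alpha) * - (alpha / 2) = 1) ?Rpower_1 //; field; lra.
Qed.

Theorem theorem1 (alpha : R) (m : nat -> nat) (P : nat -> nat -> R)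
    (L : R -> R) (eps0 beta : R)
    (Halpha : (1 < alpha < 2))
    (HP : forall n, is_prob_law (m n) (P n))
    (Hm : forall M : nat, exists N, forall n, (N <= n)%N -> (M <= m n)%N)
    (HL : slowly_varying L)
    (Heps0 : (0 < eps0 < /2))
    (HA : condA m P)
    (HPL : condPL m P alpha L eps0)
    (Hbeta : (Rmax (2 - alpha) (alpha - 1) < beta))
    (Hmbeta : exists c N, (0 < c) /\
        forall n, (N <= n)%N -> (c * Rpower (INR n) beta <= INR (m n))) :
  forall eps, (0 < eps) ->
    Un_cv (fun n => @rig_prob n (m n) (P n)
             (fun f : config n (m n) => Rltb eps
                (Rabs (INR (clique_number f)
                       / (Rpower (1 - alpha / 2) (- (alpha / 2)) * Kn L alpha n)
                       - 1))))
          0.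
Proof.
move=> eps eps_gt0; apply/ev_Un_cv => d d0.
set a := 1 - alpha / 2; set c := Rpower a _.
have a0 : 0 < a by rewrite /a; lra.
have c0 : 0 < c := Rpower_gt0 _ _.
pose e := Rmin eps (1 / 2).
have e0 : 0 < e by apply: Rmin_glb_lt; lra.
have ee : e <= eps := Rmin_l _ _.
have e1 : e <= 1 / 2 := Rmin_r _ _.
(* r = 1 + e/4 gives a threshold below a for the upper bound, r = 1 - e/4 one above a for the lower
   bound; the limiting counts are r a^(-alpha/2) K(n). *)
have [tu0 tuE] := @scaled_threshold alpha a (1 + e / 4) Halpha a0 ltac:(lra).
have [tl0 tlE] := @scaled_threshold alpha a (1 - e / 4) Halpha a0 ltac:(lra).
set tu := a * Rpower (1 + e / 4) _ in tu0 tuE.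
set tl := a * Rpower (1 - e / 4) _ in tl0 tlE.
have al2 : 0 < 2 / alpha by apply: Rdiv_lt_0_compat; lra.
have tua : tu < a.
  have : Rpower (1 + e / 4) (- (2 / alpha)) < 1.
    by rewrite -[X in _ < X](Rpower_O (1 + e / 4)); [apply: Rpower_lt; lra | lra].
  by move/(Rmult_lt_compat_l a _ _ a0); rewrite /tu; lra.
have tla : a < tl.
  have : 1 < Rpower (1 - e / 4) (- (2 / alpha)).
    rewrite -[X in X < _]exp_0 /Rpower; apply: exp_increasing.
    have : ln (1 - e / 4) < ln 1 by apply: ln_increasing; lra.
    by rewrite ln_1 => /(Rmult_lt_compat_l (2 / alpha) _ _ al2); lra.
  by move/(Rmult_lt_compat_l a _ _ a0); rewrite /tl; lra.
have [g [g0 hU]] := @clique_number_upper_tail alpha m P L eps0 beta Halpha HP HL Heps0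
  HA HPL Hbeta Hmbeta tu (e / 8) (conj tu0 tua) ltac:(lra).
have hL := @clique_number_lower_tail alpha m P L eps0 Halpha HP Hm HL Heps0
  HPL tl (e / 8) (d / 2) tla ltac:(lra) ltac:(lra).
have ce : 0 < c * (e / 4) by apply: Rmult_lt_0_compat; lra.
have /ev_Un_cv/(_ _ ce) cu := tail_Kn HL Heps0 HPL tu0.
have /ev_Un_cv/(_ _ ce) cl := tail_Kn HL Heps0 HPL tl0.
apply: (ev_mp hL); apply: (ev_mp (hU (d / 2) ltac:(lra))).
apply: (ev_mp cu); apply: (ev_mp cl).
apply: ev_mp (@Kn_bounds alpha m P L eps0 Halpha HP HL Heps0 HPL (g / 2) ltac:(lra)) _.
apply: ev_mp (@Rpower_large (8 / (e * c)) (g / 2) ltac:(lra)) _.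
apply: ev_all => n n1 [n2 _] /Rabs_def2 [_ l2] /Rabs_def2 [u1 _] pU pL.
set K := Kn L alpha n in l2 u1 n2 *.
have K0 : 0 < K by apply: Rlt_le_trans n2; exact: Rpower_gt0.
have Z0 : 0 < c * K by apply: Rmult_lt_0_compat.
rewrite -/a -/c in tuE tlE n2 pU.
rewrite tuE in u1; rewrite tlE in l2.
have scale tau : expected_large m P tau n = expected_large m P tau n / K * K.
  by field; lra.
have up : expected_large m P tu n <= (1 + e / 2) * (c * K).
  rewrite scale -Rmult_assoc; apply: Rmult_le_compat_r; lra.
have lo : (1 - e / 2) * (c * K) <= expected_large m P tl n.
  rewrite scale -Rmult_assoc; apply: Rmult_le_compat_r; lra.
(* The small vertices are negligible since K(n) >= n^(a - g/2); the share e/4 is what (1 + e/8)(1 +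
   e/2) <= 1 + 3e/4 leaves of e. *)
have sm : 2 * Rpower (INR n) (a - g) <= e / 4 * (c * K).
  have ec : 0 < e * c by apply: Rmult_lt_0_compat.
  have h1 : 8 <= e * c * Rpower (INR n) (g / 2).
    have := Rmult_le_compat_l (e * c) _ _ ltac:(lra) n1.
    by rewrite (_ : e * c * (8 / (e * c)) = 8) //; field; lra.
  have h2 : Rpower (INR n) (a - g / 2) = Rpower (INR n) (a - g) * Rpower (INR n) (g / 2).
    by rewrite -Rpower_plus; congr Rpower; lra.
  have h3 := Rmult_le_compat_l (e * c) _ _ ltac:(lra) n2.
  have h4 := Rmult_le_compat_r (Rpower (INR n) (a - g)) _ _ (Rlt_le _ _ (Rpower_gt0 _ _)) h1.
  rewrite h2 in h3; lra.
have e20 : 0 <= e * e by apply: Rmult_le_pos; lra.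
have e2 : e * e <= e * (1 / 2) by apply: Rmult_le_compat_l; lra.
have up' : (1 + e / 8) * expected_large m P tu n + 2 * Rpower (INR n) (a - g) <= (1 + e) * (c * K).
  have h1 := Rmult_le_compat_l (1 + e / 8) _ _ ltac:(lra) up.
  have h2 : (1 + e / 8) * (1 + e / 2) <= 1 + 3 / 4 * e by lra.
  have := Rmult_le_compat_r (c * K) _ _ ltac:(lra) h2; lra.
have lo' : (1 - e) * (c * K) <= (1 - 2 * (e / 8)) * expected_large m P tl n.
  have h1 := Rmult_le_compat_l (1 - 2 * (e / 8)) _ _ ltac:(lra) lo.
  have h2 : 1 - e <= (1 - 2 * (e / 8)) * (1 - e / 2) by lra.
  have := Rmult_le_compat_r (c * K) _ _ ltac:(lra) h2; lra.
set E := (X in rig_prob _ X).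
have split_le : rig_prob (P n) E <=
    rig_prob (P n) (fun f : config n (m n) =>
      Rltb ((1 + e / 8) * expected_large m P tu n + 2 * Rpower (INR n) (a - g))
        (INR (clique_number f)))
  + rig_prob (P n) (fun f : config n (m n) =>
      Rltb (INR (clique_number f)) ((1 - 2 * (e / 8)) * expected_large m P tl n)).
  apply: rig_prob_or => // f; rewrite /E /Rltb.
  case: Rlt_dec => // hE _.
  have w : INR (clique_number f) = INR (clique_number f) / (c * K) * (c * K) by field; lra.
  case: Rlt_dec => //= h1; case: Rlt_dec => //= h2; exfalso.
  set x := INR (clique_number f) / (c * K) in hE w.
  have x1 : x <= 1 + e by apply: (Rmult_le_reg_r (c * K)) => //; lra.
  have x2 : 1 - e <= x by apply: (Rmult_le_reg_r (c * K)) => //; lra.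
  by move: hE; apply: Rle_not_lt; apply: Rabs_le; lra.
have p0 := @rig_prob_ge0 n (m n) (P n) E (HP n).
by rewrite Rminus_0_r Rabs_pos_eq //; lra.
Qed.
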